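(* Let $f:\mathbb{R}^n\to\mathbb{R}$ be twice continuously differentiable, let $\{x_k\}$ be generated by the MINRES-based linesearch method described in the context, and let $\mathcal A:=\{x^*:\liminf_{k\to\infty}\|x_k-x^*\|=0\}$ be the set of accumulation points of $\{x_k\}$. Suppose that: (1) $\nabla^2 f$ is locally Lipschitz continuous on a neighborhood $V_H$ of $\mathcal A$; (2) $B_k=\nabla^2 f(x_k)$ for all $k\in\mathbb{N}$; (3) with $\mathcal N:=\{k:\lambda_{\min}(\bar B_k)\le0\}$ and $\mathcal N_{\mathrm{npc}}:=\{k\in\mathcal N:\mathrm{flag}_k=\mathrm{NPC}\}$, the implication $|\mathcal N|=\infty\implies|\mathcal N_{\mathrm{npc}}|=\infty$ holds; (4) $\zeta_k=\min\{\mathsf Z,z_k\|g_k\|^{\zeta}\}$ for all $k$, where $\mathsf Z>0$, $\zeta\in(0,\frac13]$, $z_k\ge\bar z>0$, $z_k=\mathcal O((k\log(k)^2)^{\zeta})$ as $k\to\infty$, and moreover $\sum_{k=1}^\infty a_k^{-1/\alpha}<\infty$ and $\sum_{k=1}^\infty z_k^{-1/\zeta}<\infty$. Suppose that the method does not stop after finitely many iterations. Let $x^*\in\mathcal A$ be an accumulation point of $\{x_k\}$ at which $f$ satisfies the Łojasiewicz property with some exponent $\theta\in[0,1)$. Then $\{x_k\}$ converges to $x^*$ and we have $\nabla f(x^* )=0$ and $\nabla^2 f(x^* )\succeq0$.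
   Context: Notation: $\|\cdot\|$ is the Euclidean norm for vectors and the spectral norm for matrices; $\mathbb S_n$ is the set of symmetric real $n\times n$ matrices; $g_k:=\nabla f(x_k)$; $\lambda_{\min}$ is the smallest eigenvalue; $A\succeq0$ means $A$ is positive semidefinite. Łojasiewicz property: $f$ has the Łojasiewicz property at $\bar x$ with exponent $\theta\in[0,1)$ if there exist $c>0$, $\eta\in(0,\infty]$ and a neighborhood $V$ of $\bar x$ such that, with $\varrho(t)=ct^{1-\theta}$, $\varrho'(f(x)-f(\bar x))\,\|\nabla f(x)\|\ge1$ for all $x\in V$ with $0<f(x)-f(\bar x)<\eta$. MINRES routine (exact arithmetic). Given $A\in\mathbb S_n$, $b\in\mathbb{R}^n\setminus\{0\}$ and a tolerance $\theta\ge 0$, let $\mathcal K_t(A,b)=\mathrm{span}\{b,Ab,\dots,A^{t-1}b\}$, $p_0=0$, $p_t=\mathrm{argmin}_{p\in\mathcal K_t(A,b)}\|b-Ap\|$ and $r_t=b-Ap_t$. $\mathrm{MINRES}(A,b,\theta)$ performs, for $t=1,2,\dots$: (1) if $r_{t-1}^\top A r_{t-1}\le 0$ (non-positive curvature is detected), stop and return $d=\|b\|\, r_{t-1}/\|r_{t-1}\|$ with flag NPC; (2) otherwise compute $p_t$; if $\|r_t\|\le\theta\|b\|$, stop and return $d=p_t$ with flag SOL; otherwise continue with $t+1$. MINRES-based linesearch method. Input: $x_0\in\mathbb{R}^n$, $\rho,\sigma\in(0,1)$, $\alpha\in(0,1]$, $\mathsf A\in(0,1]$, $s>0$, tolerances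 $\theta_k\ge0$, parameters $a_k\ge\bar a>0$, and $\zeta_k\ge 0$. For $k=0,1,\dots$: set $g_k=\nabla f(x_k)$, choose $B_k\in\mathbb S_n$ (an approximation of $\nabla^2 f(x_k)$), and set $\bar B_k=B_k+\zeta_k I$. If $g_k=0$, stop. Otherwise compute $(d_k,\mathrm{flag}_k)$ by $\mathrm{MINRES}(\bar B_k,-g_k,\theta_k)$. If $\mathrm{flag}_k=\mathrm{SOL}$ and $d_k^\top\bar B_kd_k<\min\{\mathsf A,a_k\|g_k\|^{\alpha}\}\|d_k\|^2$, then reset $d_k=-g_k$ and $\mathrm{flag}_k=\mathrm{GD}$. Determine the step size $\lambda_k$ as follows and set $x_{k+1}=x_k+\lambda_kd_k$: - If $\mathrm{flag}_k\in\{\mathrm{SOL},\mathrm{GD}\}$: $\lambda_k=s\rho^j$ with $j\ge0$ the smallest integer such that $f(x_k+\lambda_kd_k)-f(x_k)\le\sigma\lambda_kd_k^\top g_k$. - If $\mathrm{flag}_k=\mathrm{NPC}$: consider the condition $(\ast)$ $f(x_k+\lambda d_k)-f(x_k)\le\sigma\lambda g_k^\top d_k+\frac{\sigma}{2}\lambda^2d_k^\top B_kd_k$. If $(\ast)$ fails for $\lambda=s$, then $\lambda_k=s\rho^j$ with $j$ the smallest positive integer such that $(\ast)$ holds for $\lambda = s\rho^j$. If $(\ast)$ holds for $\lambda=s$, then $\lambda_k=s\rho^{-j}$ with $j\ge0$ the largest integer such that $(\ast)$ holds for all $\lambda=s,s\rho^{-1},\dots,s\rho^{-j}$ (forward linesearch).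 Whenever the method is said to generate $\{x_k\}$, it is implicitly assumed that each forward linesearch stops after finitely many steps. *)

(* Defs.v *)
From HB Require Import structures.
From mathcomp Require Import all_boot all_order all_algebra.
From mathcomp Require Import all_classical all_reals all_analysis.
Set Implicit Arguments.
Unset Strict Implicit.
Unset Printing Implicit Defensive.
Import Order.TTheory GRing.Theory Num.Theory.
Import numFieldNormedType.Exports.
Local Open Scope classical_set_scope.
Local Open Scope ring_scope.

(* The library norm of 'M[R]_(m, n) is the max norm. It induces the usual
   topology, so limits, neighborhoods and differentiability are the library's;
   the Euclidean and spectral norms are defined separately. *)

Definition dot (R : realType) (n : nat) (u v : 'cV[R]_n) : R :=
  \sum_i u i 0 * v i 0.

Definition norm2 (R : realType) (n : nat) (u : 'cV[R]_n) : R :=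
  Num.sqrt (dot u u).

Definition spectral_norm (R : realType) (n : nat) (A : 'M[R]_n) : R :=
  sup [set norm2 (A *m v) | v in [set v : 'cV[R]_n | norm2 v <= 1]].

(* For n > 0 and A symmetric, the set of eigenvalues is finite and nonempty, so
   that inf is its minimum. *)
Definition lambda_min (R : realType) (n : nat) (A : 'M[R]_n) : R :=
  inf [set l : R | eigenvalue A l].

Definition psd (R : realType) (n : nat) (A : 'M[R]_n) : Prop :=
  A \is symmetricmx /\ forall v : 'cV[R]_n, 0 <= dot v (A *m v).

Definition grad (R : realType) (n : nat) (f : 'cV[R]_n -> R) (x : 'cV[R]_n) :
    'cV[R]_n :=
  \col_i 'D_(delta_mx i 0) f x.

Definition hess (R : realType) (n : nat) (f : 'cV[R]_n -> R) (x : 'cV[R]_n) :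
    'M[R]_n :=
  \matrix_(i, j) 'D_(delta_mx i 0) (fun y => grad f y j 0) x.

Definition twice_continuously_differentiable (R : realType) (n : nat)
    (f : 'cV[R]_n -> R) : Prop :=
  [/\ forall x, differentiable f x,
      forall x, differentiable (grad f) x &
      continuous (hess f)].

Definition locally_lipschitz_on (R : realType) (n : nat) (V : set 'cV[R]_n)
    (H : 'cV[R]_n -> 'M[R]_n) : Prop :=
  forall x, V x -> exists (L : R) (U : set 'cV[R]_n), nbhs x U /\
    forall y z, (U `&` V) y -> (U `&` V) z ->
      spectral_norm (H y - H z) <= L * norm2 (y - z).

Definition lojasiewicz (R : realType) (n : nat) (f : 'cV[R]_n -> R)
    (xbar : 'cV[R]_n) (theta : R) : Prop :=
  exists (c : R) (eta : \bar R) (V : set 'cV[R]_n),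
    [/\ 0 < c, (0 < eta)%E, nbhs xbar V &
      let desing (t : R) : R := c * t `^ (1 - theta) in
      forall x, V x -> 0 < f x - f xbar -> ((f x - f xbar)%:E < eta)%E ->
        1 <= derive1 desing (f x - f xbar) * norm2 (grad f x)].

(* The lower limit is taken in \bar R: the real-valued limn_inf has a default
   value when the sequence of distances tends to infinity. *)
Definition accumulation_points (R : realType) (n : nat)
    (x : nat -> 'cV[R]_n) : set 'cV[R]_n :=
  [set xs | limn_einf (fun k => (norm2 (x k - xs))%:E) = 0%E].

Inductive flag := SOL | NPC | GD.

Definition krylov (R : realType) (n : nat) (A : 'M[R]_n) (b : 'cV[R]_n)
    (t : nat) : {vspace 'cV[R]_n} :=
  (<<[seq iter i (mulmx A) b | i <- iota 0 t]>>)%VS.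

Definition is_minres_iterate (R : realType) (n : nat) (A : 'M[R]_n)
    (b : 'cV[R]_n) (t : nat) (p : 'cV[R]_n) : Prop :=
  p \in krylov A b t /\
  forall q, q \in krylov A b t -> norm2 (b - A *m p) <= norm2 (b - A *m q).

(* MINRES(A, b, tol) returns (d, fl): the routine does not stop in the steps
   1, ..., t.-1, and stops in step t with output (d, fl). As long as the routine
   has not stopped before step t, the argmin defining p_t is unique unless step
   t itself stops with NPC, so the choice of p is immaterial. *)
Definition minres (R : realType) (n : nat) (A : 'M[R]_n) (b : 'cV[R]_n)
    (tol : R) (d : 'cV[R]_n) (fl : flag) : Prop :=
  exists p : nat -> 'cV[R]_n,
    [/\ p 0%N = 0, forall t, (0 < t)%N -> is_minres_iterate A b t (p t) &
    let r t := b - A *m p t in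
    let npc_stop t := dot (r t.-1) (A *m r t.-1) <= 0 in
    let sol_stop t := norm2 (r t) <= tol * norm2 b in
    exists t, [/\ (0 < t)%N,
      forall i, (0 < i < t)%N -> ~~ npc_stop i && ~~ sol_stop i &
      if npc_stop t then
        d = (norm2 b / norm2 (r t.-1)) *: r t.-1 /\ fl = NPC
      else sol_stop t /\ (d = p t /\ fl = SOL)]].

Record minres_params (R : realType) := MinresParams {
  ls_rho : R;
  ls_sigma : R;
  ls_alpha : R;
  ls_capA : R;
  ls_s : R;
  ls_tol : nat -> R;
  ls_a : nat -> R;
  ls_zeta : nat -> R;
  ls_rho_range : 0 < ls_rho < 1;
  ls_sigma_range : 0 < ls_sigma < 1;
  ls_alpha_range : 0 < ls_alpha <= 1;
  ls_capA_range : 0 < ls_capA <= 1;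
  ls_s_gt0 : 0 < ls_s;
  ls_tol_ge0 : forall k, 0 <= ls_tol k;
  ls_a_lower : exists2 abar : R, 0 < abar & forall k, abar <= ls_a k;
  ls_zeta_ge0 : forall k, 0 <= ls_zeta k }.

Definition Bbar (R : realType) (n : nat) (P : minres_params R)
    (B : nat -> 'M[R]_n) (k : nat) : 'M[R]_n :=
  B k + (ls_zeta P k)%:M.

Definition direction_step (R : realType) (n : nat) (P : minres_params R)
    (k : nat) (g : 'cV[R]_n) (Bb : 'M[R]_n) (d : 'cV[R]_n) (fl : flag) : Prop :=
  exists (d' : 'cV[R]_n) (fl' : flag), minres Bb (- g) (ls_tol P k) d' fl' /\
    let small_curvature :=
      dot d' (Bb *m d') <
        Num.min (ls_capA P) (ls_a P k * norm2 g `^ ls_alpha P) * norm2 d' ^+ 2 in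
    if (if fl' is SOL then true else false) && small_curvature
    then d = - g /\ fl = GD
    else d = d' /\ fl = fl'.

Definition armijo (R : realType) (n : nat) (P : minres_params R)
    (f : 'cV[R]_n -> R) (x d : 'cV[R]_n) (l : R) : Prop :=
  f (x + l *: d) - f x <= ls_sigma P * l * dot d (grad f x).

Definition armijo_npc (R : realType) (n : nat) (P : minres_params R)
    (f : 'cV[R]_n -> R) (x d : 'cV[R]_n) (B : 'M[R]_n) (l : R) : Prop :=
  f (x + l *: d) - f x <=
    ls_sigma P * l * dot (grad f x) d +
      ls_sigma P / 2 * l ^+ 2 * dot d (B *m d).

Definition backward_linesearch (R : realType) (P : minres_params R)
    (j0 : nat) (C : R -> Prop) (l : R) : Prop :=
  exists j : nat,
    [/\ (j0 <= j)%N, l = ls_s P * ls_rho P ^+ j, C (ls_s P * ls_rho P ^+ j) &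
      forall i, (j0 <= i)%N -> C (ls_s P * ls_rho P ^+ i) -> (j <= i)%N].

Definition forward_linesearch (R : realType) (P : minres_params R)
    (C : R -> Prop) (l : R) : Prop :=
  let ok j := forall i, (i <= j)%N -> C (ls_s P * ls_rho P ^- i) in
  exists j : nat, [/\ l = ls_s P * ls_rho P ^- j, ok j &
    forall i, ok i -> (i <= j)%N].

Definition stepsize (R : realType) (n : nat) (P : minres_params R)
    (f : 'cV[R]_n -> R) (x d : 'cV[R]_n) (B : 'M[R]_n) (fl : flag) (l : R) :
    Prop :=
  match fl with
  | SOL | GD => backward_linesearch P 0 (armijo P f x d) l
  | NPC => let C := armijo_npc P f x d B in
      (~ C (ls_s P) /\ backward_linesearch P 1 C l) \/
      (C (ls_s P) /\ forward_linesearch P C l)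
  end.

(* The sequences are constrained only up to the iteration in which the method
   stops, that is, the first k with grad f (x k) = 0. *)
Definition minres_linesearch (R : realType) (n : nat) (P : minres_params R)
    (f : 'cV[R]_n -> R) (x : nat -> 'cV[R]_n) (B : nat -> 'M[R]_n)
    (d : nat -> 'cV[R]_n) (fl : nat -> flag) (lam : nat -> R) : Prop :=
  forall k, (forall i, (i < k)%N -> grad f (x i) != 0) ->
    B k \is symmetricmx /\
    (grad f (x k) != 0 ->
      [/\ direction_step P k (grad f (x k)) (Bbar P B k) (d k) (fl k),
          stepsize P f (x k) (d k) (B k) (fl k) (lam k) &
          x k.+1 = x k + lam k *: d k]).

(* Main.v *)
Require Import Defs.
From HB Require Import structures.
From mathcomp Require Import all_boot all_order all_algebra.
From mathcomp Require Import ring lra.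
From mathcomp Require Import all_classical all_reals all_analysis.
Set Implicit Arguments.
Unset Strict Implicit.
Unset Printing Implicit Defensive.
Import Order.TTheory GRing.Theory Num.Theory.
Import numFieldNormedType.Exports.
Local Open Scope classical_set_scope.
Local Open Scope ring_scope.

(** The proof rests on the decrease of f in one iteration, measured against the
    length of the step, near an accumulation point xs.

    The MINRES residuals r_0, ..., r_(t-1) of positive curvature are conjugate,
    so that they form a basis of the Krylov space, and r_i . r_t = |r_t|^2 for
    all i <= t. Hence the iterate p_t is a nonnegative combination of them, which
    gives b . p_t >= p_t . A p_t ([iterate_descent]); and if p_t has curvature at
    least w, then so has some residual, along which a single step already reduces
    the residual norm, which bounds |p_t| below by a multiple of w |b|
    ([iterate_lower]).

    In a descent iteration (flag SOL or GD), either the directional derivative is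
    at most a negative multiple of |g| |d|, or the step is at most s a_k^(-1/alpha),
    which is summable. In a negative curvature iteration the linesearch fails at
    the next longer step; compared with the cubic Taylor remainder, this makes the
    step at least a multiple of zeta_k, so f drops by a multiple of zeta_k^3,
    and zeta_k^3 dominates |g_k| because zeta <= 1/3 ([gradient_le_zeta3]). So, up
    to a summable term, the step is bounded by the decrease of f divided by |g|
    ([iteration_length]), and the Lojasiewicz inequality turns this into a
    telescoping bound ([lojasiewicz_length]). The distance to xs plus the
    remaining length then does not increase, which traps the sequence
    ([trapped]): it converges.

    If the limit were not stationary, every iteration would lower f by a fixed
    amount ([grad_limit]). A negative curvature iteration near the limit would
    leave a gap f(x_k) - f(xs) of at least a multiple of |g_k|, which the
    Lojasiewicz inequality excludes once |g_k| is small ([eventually_not_NPC]); so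
    such iterations, and with them the iterations with a nonpositive eigenvalue,
    stop occurring.

    It remains to see that zeta_k is small infinitely often
    ([zeta_often_small]). Otherwise the growth condition on z_k gives
    |g_k| >= c k^-(1+eps) for each eps > 0. The decrease of f is at least a
    multiple of w_k^4 |g_k|^2, where w_k is the curvature threshold, and the
    Lojasiewicz inequality turns this into the summability of w_k^4 |g_k|^q with
    some q < 1. Where the summable a_k^(-1/alpha) is below 1/k, the threshold w_k
    is at least a small negative power of k, so 1/k is bounded by the sum of these
    two summable terms: a contradiction. *)

(** * Euclidean norm and symmetric matrices *)

Section Euclidean.
Context {R : realType} {n : nat}.
Implicit Types (u v w : 'cV[R]_n) (A : 'M[R]_n).

Lemma dotC u v : dot u v = dot v u.
Proof. by apply: eq_bigr => i _; rewrite mulrC. Qed.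

Lemma dotDl u v w : dot (u + v) w = dot u w + dot v w.
Proof. by rewrite -big_split; apply: eq_bigr => i _; rewrite mxE mulrDl. Qed.

Lemma dotZl a u v : dot (a *: u) v = a * dot u v.
Proof. by rewrite mulr_sumr; apply: eq_bigr => i _; rewrite mxE mulrA. Qed.

Lemma dotNl u v : dot (- u) v = - dot u v.
Proof. by rewrite -scaleN1r dotZl mulN1r. Qed.

Lemma dotDr u v w : dot w (u + v) = dot w u + dot w v.
Proof. by rewrite dotC dotDl !(dotC w). Qed.

Lemma dotZr a u v : dot u (a *: v) = a * dot u v.
Proof. by rewrite dotC dotZl (dotC u). Qed.

Lemma dotNr u v : dot u (- v) = - dot u v.
Proof. by rewrite dotC dotNl dotC. Qed.

Definition dotE := (dotDl, dotDr, dotZl, dotZr, dotNl, dotNr).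

Lemma dot0l u : dot 0 u = 0.
Proof. by rewrite -(scale0r 0) dotZl mul0r. Qed.

Lemma dot0r u : dot u 0 = 0.
Proof. by rewrite dotC dot0l. Qed.

Lemma dot_suml (I : finType) (F : I -> 'cV[R]_n) v :
  dot (\sum_i F i) v = \sum_i dot (F i) v.
Proof.
by apply: (big_morph (fun u => dot u v)) => [u w|]; rewrite ?dotDl ?dot0l.
Qed.

Lemma dot_sumr (I : finType) (F : I -> 'cV[R]_n) v :
  dot v (\sum_i F i) = \sum_i dot v (F i).
Proof. by rewrite dotC dot_suml; apply: eq_bigr => i _; rewrite dotC. Qed.

Lemma dot_trmx A u v : dot (A *m u) v = dot u (A^T *m v).
Proof.
have dotM (x y : 'cV[R]_n) : dot x y = (x^T *m y) 0 0.
  by rewrite mxE; apply: eq_bigr => i _; rewrite mxE.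
by rewrite !dotM trmx_mul mulmxA.
Qed.

Lemma symmetricmx_tr A : A \is symmetricmx -> A^T = A.
Proof. by move=> /is_hermitianmxP; rewrite expr0 scale1r map_mx_id. Qed.

Lemma dot_sym A u v : A \is symmetricmx -> dot (A *m u) v = dot u (A *m v).
Proof. by move=> /symmetricmx_tr sA; rewrite dot_trmx sA. Qed.

Lemma dot_ge0 u : 0 <= dot u u.
Proof. by apply: sumr_ge0 => i _; rewrite -expr2 sqr_ge0. Qed.

Lemma dot_eq0 u : (dot u u == 0) = (u == 0).
Proof.
apply/idP/eqP => [|->]; last by rewrite dot0l.
rewrite psumr_eq0 => [|i _]; last by rewrite -expr2 sqr_ge0.
move=> /allP u0; apply/matrixP => i j; rewrite ord1 mxE.
by have := u0 i (mem_index_enum i); rewrite /= mulf_eq0 orbb => /eqP.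
Qed.

Lemma norm2_ge0 u : 0 <= norm2 u.
Proof. exact: sqrtr_ge0. Qed.

Lemma norm2_sqr u : norm2 u ^+ 2 = dot u u.
Proof. by rewrite sqr_sqrtr// dot_ge0. Qed.

Lemma norm2_sqrB u v :
  norm2 (u - v) ^+ 2 = norm2 u ^+ 2 - 2 * dot u v + norm2 v ^+ 2.
Proof. by rewrite !norm2_sqr !dotE (dotC v u); ring. Qed.

Lemma norm2_eq0 u : (norm2 u == 0) = (u == 0).
Proof. by rewrite -dot_eq0 -norm2_sqr expf_eq0. Qed.

Lemma norm2_gt0 u : (0 < norm2 u) = (u != 0).
Proof. by rewrite lt_def norm2_ge0 andbT norm2_eq0. Qed.

Lemma norm20 : norm2 (0 : 'cV[R]_n) = 0.
Proof. by apply/eqP; rewrite norm2_eq0. Qed.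

Lemma norm2Z a u : norm2 (a *: u) = `|a| * norm2 u.
Proof. by rewrite /norm2 !dotE mulrA -expr2 sqrtrM ?sqr_ge0// sqrtr_sqr. Qed.

Lemma norm2N u : norm2 (- u) = norm2 u.
Proof. by rewrite -scaleN1r norm2Z normrN1 mul1r. Qed.

Lemma norm2B u v : norm2 (u - v) = norm2 (v - u).
Proof. by rewrite -norm2N opprB. Qed.

Lemma CauchySchwarz_dot u v : dot u v <= norm2 u * norm2 v.
Proof.
have [->|v0] := eqVneq v 0; first by rewrite dot0r norm20 mulr0.
have vv : 0 < norm2 v by rewrite norm2_gt0.
have [uv|uv] := lerP (dot u v) 0.
  by rewrite (le_trans uv)// mulr_ge0// norm2_ge0.
rewrite -ler_sqr ?nnegrE ?(ltW uv) ?mulr_ge0 ?norm2_ge0// exprMn.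
(* The component of u orthogonal to v, scaled by |v|^2, has nonnegative norm. *)
have := dot_ge0 (norm2 v ^+ 2 *: u - dot u v *: v).
rewrite !dotE -!norm2_sqr (dotC v u) => h.
rewrite -(ler_pM2l (exprn_gt0 2 vv)); nra.
Qed.

Lemma ler_norm_dot u v : `|dot u v| <= norm2 u * norm2 v.
Proof.
by rewrite ler_norml CauchySchwarz_dot lerNl -dotNl -(norm2N u) CauchySchwarz_dot.
Qed.

Lemma ler_norm2D u v : norm2 (u + v) <= norm2 u + norm2 v.
Proof.
rewrite -ler_sqr ?nnegrE ?addr_ge0 ?norm2_ge0// norm2_sqr !dotE.
rewrite sqrrD !norm2_sqr (dotC v u).
by have := CauchySchwarz_dot u v; lra.
Qed.

Lemma ler_norm2_sum (I : finType) (F : I -> 'cV[R]_n) :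
  norm2 (\sum_i F i) <= \sum_i norm2 (F i).
Proof.
elim/big_ind2: _ => [|x1 x2 y1 y2 h1 h2|//]; first by rewrite norm20.
by rewrite (le_trans (ler_norm2D _ _))// lerD.
Qed.

(** The norm topology of the library is that of the entrywise maximum; the next
    two bounds make the Euclidean balls a basis of the same neighborhoods. *)
Lemma mx_norm_le_norm2 u : `|u| <= norm2 u.
Proof.
rewrite [`|u|]/Num.Def.normr/= mx_normrE.
apply: bigmax_le => [|[i j] _ /=]; first exact: norm2_ge0.
rewrite ord1 -(@ler_sqr _ `|_|) ?nnegrE ?norm2_ge0// norm2_sqr real_normK ?num_real//.
rewrite /dot (bigD1 i)//= -expr2 lerDl; apply: sumr_ge0 => k _.
by rewrite -expr2 sqr_ge0.
Qed.

Lemma norm2_delta (i : 'I_n) : norm2 (delta_mx i 0 : 'cV[R]_n) = 1.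
Proof.
rewrite /norm2 /dot (bigD1 i)//= !mxE !eqxx mulr1 big1 ?addr0 ?sqrtr1// => k ki.
by rewrite !mxE (negPf ki) mul0r.
Qed.

Lemma norm2_le_mx_norm u : norm2 u <= n%:R * `|u|.
Proof.
have -> : u = \sum_i u i 0 *: delta_mx i 0.
  by rewrite {1}[u]matrix_sum_delta; apply: eq_bigr => i _; rewrite big_ord1.
apply: (le_trans (ler_norm2_sum _)).
set w := (X in n%:R * `|X|); have -> : w = u.
  by rewrite [RHS]matrix_sum_delta; apply: eq_bigr => i _; rewrite big_ord1.
rewrite -[X in X%:R]card_ord mulr_natl -sumr_const; apply: ler_sum => i _.
rewrite norm2Z norm2_delta mulr1 [X in _ <= X]/Num.Def.normr/= mx_normrE.
by rewrite (bigmax_sup (i, 0)).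
Qed.

Lemma norm2_mulmx A u : norm2 (A *m u) <= (n%:R * n%:R * `|A|) * norm2 u.
Proof.
have mx_le m p (C : 'M[R]_(m, p)) i j : `|C i j| <= `|C|.
  by rewrite [X in _ <= X]/Num.Def.normr/= mx_normrE (bigmax_sup (i, j)).
rewrite (le_trans (norm2_le_mx_norm _))// -!mulrA ler_wpM2l//.
rewrite [X in X <= _]/Num.Def.normr/= mx_normrE.
apply: bigmax_le => [|[i j] _ /=]; first by rewrite !mulr_ge0// norm2_ge0.
rewrite mxE (le_trans (ler_norm_sum _ _ _))//.
rewrite -[X in _ <= X%:R * _]card_ord mulr_natl -sumr_const; apply: ler_sum => k _.
rewrite normrM ler_pM// (le_trans (mx_le _ _ _ _ _))//.
exact: mx_norm_le_norm2.
Qed.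

Lemma norm2_spectral_norm A u : norm2 (A *m u) <= spectral_norm A * norm2 u.
Proof.
have [->|u0] := eqVneq u 0; first by rewrite mulmx0 norm20 mulr0.
have u1 : 0 < norm2 u by rewrite norm2_gt0.
rewrite -ler_pdivrMr//; apply: ub_le_sup.
  exists (n%:R * n%:R * `|A|) => _ [v /= v1 <-].
  by rewrite (le_trans (norm2_mulmx _ _))// ler_piMr// !mulr_ge0.
exists ((norm2 u)^-1 *: u) => /=.
  by rewrite norm2Z ger0_norm ?invr_ge0 ?norm2_ge0// mulVf// gt_eqF.
by rewrite -scalemxAr norm2Z ger0_norm ?invr_ge0 ?norm2_ge0// mulrC.
Qed.

Lemma nbhs_norm2_ball v (V : set 'cV[R]_n) : nbhs v V ->
  exists2 r : R, 0 < r & forall y, norm2 (y - v) < r -> V y.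
Proof.
move=> /nbhs_ballP[r /= r0 rV]; exists r => // y yv; apply: rV.
by rewrite -ball_normE/= distrC (le_lt_trans (mx_norm_le_norm2 _)).
Qed.

Lemma cvg_norm2 (x : nat -> 'cV[R]_n) v :
  (forall e : R, 0 < e -> exists K : nat, forall k, (K <= k)%N -> norm2 (x k - v) < e) ->
  x @ \oo --> v.
Proof.
move=> h; apply/cvgrPdist_lt => e e0; have [K Ke] := h _ e0.
exists K => // k /= /Ke; rewrite distrC; apply: le_lt_trans.
exact: mx_norm_le_norm2.
Qed.

Lemma near_norm2 (x : nat -> 'cV[R]_n) v (e : R) : x @ \oo --> v -> 0 < e ->
  \forall k \near \oo, norm2 (x k - v) < e.
Proof.
move=> /cvgrPdist_lt xv e0; have n0 : 0 < n.+1%:R :> R by [].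
apply: filterS (xv _ (divr_gt0 e0 n0)) => k; rewrite distrC ltr_pdivlMr// mulrC.
apply: le_lt_trans; rewrite (le_trans (norm2_le_mx_norm _))// ler_wpM2r//.
by rewrite ler_nat.
Qed.

(** The Cauchy-Schwarz inequality for the form of A bounds |A v|^2 by a multiple
    of the form at v, and v is recovered from A v by the inverse matrix. *)
Lemma psd_unitmx_coercive A : A \is symmetricmx -> (forall v, 0 <= dot v (A *m v)) ->
  A \in unitmx -> exists2 c : R, 0 < c & forall v, c * dot v v <= dot v (A *m v).
Proof.
move=> sA A0 Au.
pose C := n%:R * n%:R * `|A| + 1; pose D := n%:R * n%:R * `|invmx A| + 1.
have C0 : 0 < C by rewrite ltr_wpDl// !mulr_ge0.
have D0 : 0 < D by rewrite ltr_wpDl// !mulr_ge0.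
have CS u v : dot u (A *m v) ^+ 2 <= dot u (A *m u) * dot v (A *m v).
  have q t : 0 <= dot u (A *m u) + 2 * t * dot u (A *m v) + t ^+ 2 * dot v (A *m v).
    have := A0 (u + t *: v); rewrite mulmxDr -scalemxAr !dotE.
    rewrite -(dot_sym v u sA) (dotC (A *m v)) => h.
    by rewrite (le_trans h)// le_eqVlt; apply/orP; left; apply/eqP; ring.
  have [v0|v0] := eqVneq (dot v (A *m v)) 0.
    rewrite v0 mulr0; have [->//|uv] := eqVneq (dot u (A *m v)) 0; first by rewrite expr0n.
    have := q (- (dot u (A *m u) + 1) / (2 * dot u (A *m v))).
    rewrite v0 mulr0 addr0.
    have -> : 2 * (- (dot u (A *m u) + 1) / (2 * dot u (A *m v))) * dot u (A *m v)
       = - (dot u (A *m u) + 1) by field.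
    lra.
  have vp : 0 < dot v (A *m v) by rewrite lt_def v0 A0.
  have := q (- dot u (A *m v) / dot v (A *m v)).
  have -> : dot u (A *m u) + 2 * (- dot u (A *m v) / dot v (A *m v)) * dot u (A *m v) +
    (- dot u (A *m v) / dot v (A *m v)) ^+ 2 * dot v (A *m v) =
    (dot u (A *m u) * dot v (A *m v) - dot u (A *m v) ^+ 2) / dot v (A *m v) by field.
  by rewrite pmulr_lge0 ?invr_gt0// subr_ge0.
exists (C * D ^+ 2)^-1 => [|v]; first by rewrite invr_gt0 mulr_gt0// exprn_gt0.
have AvC (w : 'cV[R]_n) : norm2 (A *m w) <= C * norm2 w.
  by rewrite (le_trans (norm2_mulmx _ _))// ler_wpM2r ?norm2_ge0// lerDl.
have vD : norm2 v <= D * norm2 (A *m v).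
  rewrite -{1}(mulKmx Au v) (le_trans (norm2_mulmx _ _))// ler_wpM2r ?norm2_ge0//.
  by rewrite lerDl.
have Avv : norm2 (A *m v) ^+ 2 <= C * dot v (A *m v).
  have [->|Av0] := eqVneq (norm2 (A *m v)) 0; first by rewrite expr0n mulr_ge0// ltW.
  have Avp : 0 < norm2 (A *m v) by rewrite lt_def Av0 norm2_ge0.
  have := CS (A *m v) v; rewrite -norm2_sqr => h.
  have h2 : dot (A *m v) (A *m (A *m v)) <= C * norm2 (A *m v) ^+ 2.
    by rewrite (le_trans (CauchySchwarz_dot _ _))// mulrC expr2 mulrA ler_wpM2r ?norm2_ge0.
  rewrite -(ler_pM2l (exprn_gt0 2 Avp)) -expr2 (le_trans h)//.
  rewrite mulrA ler_wpM2r//.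
  by rewrite mulrC.
rewrite ler_pdivrMl ?mulr_gt0 ?exprn_gt0// -norm2_sqr.
have := norm2_ge0 v; have := norm2_ge0 (A *m v) => a0 b0.
rewrite mulrAC (le_trans (y := D ^+ 2 * norm2 (A *m v) ^+ 2))//.
  by rewrite -exprMn ler_sqr// nnegrE// mulr_ge0// ltW.
by rewrite mulrC ler_wpM2r// exprn_ge0// ltW.
Qed.

(** The infimum of the Rayleigh quotient is an eigenvalue, since otherwise the
    shifted matrix is coercive; so a nonpositive infimum contradicts the
    positivity of every eigenvalue. *)
Lemma lambda_min_gt0_psd A : A \is symmetricmx -> 0 < lambda_min A ->
  forall v, 0 <= dot v (A *m v).
Proof.
move=> sA lA v0; rewrite leNgt; apply/negP => v0A.
have v00 : v0 != 0 by apply: contraTneq v0A => ->; rewrite dot0l ltxx.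
pose C := n%:R * n%:R * `|A|.
(* The Rayleigh quotients, whose infimum m is shown to be an eigenvalue. *)
pose S := [set dot v (A *m v) / dot v v | v in [set v : 'cV[R]_n | v != 0]].
have vv v : v != 0 -> 0 < dot v v by move=> nz; rewrite lt_def dot_eq0 nz dot_ge0.
have SC v : - C * dot v v <= dot v (A *m v).
  have := ler_norm_dot v (A *m v); rewrite ler_norml => /andP[h _].
  apply: le_trans h; rewrite mulNr lerN2 -norm2_sqr expr2 mulrCA ler_wpM2l ?norm2_ge0//.
  exact: norm2_mulmx.
have Slb : has_lbound S.
  by exists (- C) => _ [v nz <-]; rewrite ler_pdivlMr ?vv.
have S0 : S !=set0 by exists (dot v0 (A *m v0) / dot v0 v0); exists v0.
pose m := inf S.
have mlt : m < 0.
  apply: (@le_lt_trans _ _ (dot v0 (A *m v0) / dot v0 v0)).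
    by apply: ge_inf => //; exists v0.
  by rewrite pmulr_llt0 ?invr_gt0 ?vv.
pose M := A - m%:M.
have sM : M \is symmetricmx.
  apply/is_hermitianmxP; rewrite expr0 scale1r map_mx_id//.
  by rewrite /M linearB/= tr_scalar_mx symmetricmx_tr.
have ME v : dot v (M *m v) = dot v (A *m v) - m * dot v v.
  by rewrite mulmxBl mul_scalar_mx !dotE.
have M0 v : 0 <= dot v (M *m v).
  have [->|nz] := eqVneq v 0; first by rewrite dot0l.
  by rewrite ME subr_ge0 -ler_pdivlMr ?vv//; apply: ge_inf => //; exists v.
have [Mu|Mu] := boolP (M \in unitmx).
  have [c c0 cM] := psd_unitmx_coercive sM M0 Mu.
  have : m + c <= m.
    apply: lb_le_inf => // _ [v nz <-]; rewrite ler_pdivlMr ?vv//.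
    by have := cM v; rewrite ME; lra.
  lra.
have Em : eigenvalue A m.
  by rewrite /eigenvalue /eigenspace kermx_eq0 row_free_unit.
have : lambda_min A <= m.
  apply: ge_inf => //; exists (- C) => l /= /eigenvalueP[w wA w0].
  have wT : A *m w^T = l *: w^T.
    by rewrite -{1}(symmetricmx_tr sA) -trmx_mul wA linearZ.
  have := SC w^T; rewrite wT dotZr ler_pM2r// vv//.
  by apply: contraNneq w0 => /(congr1 trmx); rewrite trmxK trmx0 => ->.
lra.
Qed.

End Euclidean.

(** * MINRES iterates *)

Section Krylov.
Context {R : realType} {n : nat} (A : 'M[R]_n) (b : 'cV[R]_n).

Lemma krylov_sub i j : (i <= j)%N -> (krylov A b i <= krylov A b j)%VS.
Proof.
move=> ij; apply: sub_span => v /mapP[k].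
rewrite mem_iota add0n => /andP[_ ki] ->; apply: map_f.
by rewrite mem_iota add0n (leq_trans ki).
Qed.

Lemma mem_krylovS t : b \in krylov A b t.+1.
Proof. by apply: memv_span; rewrite /= inE eqxx. Qed.

Lemma mulmx_krylov t v : v \in krylov A b t -> A *m v \in krylov A b t.+1.
Proof.
move=> vK; have := memv_img (linfun (mulmx A)) vK.
rewrite limg_span lfunE/=; apply: subvP; apply: sub_span => w.
rewrite -map_comp => /mapP[k]; rewrite mem_iota add0n => /andP[_ kt] ->.
have -> : (linfun (mulmx A) \o (fun i => iter i (mulmx A) b)) k =
  iter k.+1 (mulmx A) b by rewrite [LHS]lfunE.
by apply/mapP; exists k.+1; rewrite ?mem_iota.
Qed.

Lemma krylov0 v : v \in krylov A b 0 -> v = 0.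
Proof. by rewrite /krylov/= span_nil memv0 => /eqP. Qed.

Lemma dim_krylov t : (\dim (krylov A b t) <= t)%N.
Proof. by rewrite (leq_trans (dim_span _))// size_map size_iota. Qed.

End Krylov.

Section MinresIterates.
Context {R : realType} {n : nat} (A : 'M[R]_n) (b : 'cV[R]_n).
Context (p : nat -> 'cV[R]_n).
Hypothesis A_sym : A \is symmetricmx.
Hypothesis p0 : p 0%N = 0.
Hypothesis p_min : forall t, (0 < t)%N -> is_minres_iterate A b t (p t).

Let r t := b - A *m p t.

Lemma residual0 : b - A *m p 0 = b.
Proof. by rewrite p0 mulmx0 subr0. Qed.

Lemma iterate_krylov t : p t \in krylov A b t.
Proof. by case: t => [|t]; [rewrite p0 mem0v|case: (p_min (ltn0Sn t))]. Qed.

Lemma residual_krylov t : r t \in krylov A b t.+1.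
Proof. by rewrite /r memvB ?mem_krylovS// mulmx_krylov// iterate_krylov. Qed.

Lemma iterate_min t q : q \in krylov A b t -> norm2 (r t) <= norm2 (b - A *m q).
Proof.
case: t => [/krylov0 ->|t]; first by rewrite mulmx0 subr0 /r residual0.
by case: (p_min (ltn0Sn t)) => _; apply.
Qed.

(** First-order optimality of the least squares problem. *)
Lemma residual_orth t q : q \in krylov A b t -> dot (r t) (A *m q) = 0.
Proof.
(* Moving p_t by tau q would bring the residual to its minimum along A q. *)
move=> qK; have [->|Aq0] := eqVneq (A *m q) 0; first by rewrite dot0r.
have Aqp : 0 < dot (A *m q) (A *m q) by rewrite lt_def dot_eq0 Aq0 dot_ge0.
set c := dot (r t) (A *m q); pose tau := c / dot (A *m q) (A *m q).
have : norm2 (r t) <= norm2 (r t - tau *: (A *m q)).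
  rewrite {2}/r -addrA -opprD scalemxAr -mulmxDr; apply: iterate_min.
  by rewrite memvD ?iterate_krylov// memvZ.
rewrite -ler_sqr ?nnegrE ?norm2_ge0// [X in _ <= X]norm2_sqrB (norm2_sqr (tau *: _)).
rewrite !(dotZl, dotZr) -/c => h.
apply/eqP; rewrite -sqrf_eq0; apply/eqP/le_anti; rewrite sqr_ge0 andbT.
have : 0 <= - (c ^+ 2 / dot (A *m q) (A *m q)).
  have -> : - (c ^+ 2 / dot (A *m q) (A *m q)) =
     - 2 * (tau * c) + tau * (tau * dot (A *m q) (A *m q)).
    by rewrite /tau; field; rewrite gt_eqF.
  by move: h; lra.
by rewrite oppr_ge0 pmulr_lle0 ?invr_gt0.
Qed.

Lemma residual_diff i j : r i - r j = A *m (p j - p i).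
Proof. by rewrite /r mulmxBr opprB addrC subrKA. Qed.

(** Later residuals have a constant inner product with earlier ones, because
    their differences lie in the image of the Krylov space. *)
Lemma dot_residual i j : (i <= j)%N -> dot (r i) (r j) = norm2 (r j) ^+ 2.
Proof.
move=> ij; rewrite norm2_sqr; apply/eqP; rewrite -subr_eq0 -dotNl -dotDl residual_diff.
rewrite dotC residual_orth// memvB ?iterate_krylov//.
exact: (subvP (krylov_sub A b ij)) (iterate_krylov i).
Qed.

Lemma residual_le i j : (i <= j)%N -> norm2 (r j) <= norm2 (r i).
Proof.
move=> ij; apply: iterate_min.
exact: (subvP (krylov_sub A b ij)) (iterate_krylov i).
Qed.

Lemma residual_conj i j : i != j -> dot (r i) (A *m r j) = 0.
Proof.
wlog ij : i j / (i < j)%N => [h|_].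
  rewrite neq_ltn => /orP[ij|ji]; first by apply: h; rewrite // ltn_eqF.
  by rewrite -dot_sym// dotC; apply: h; rewrite // ltn_eqF.
rewrite -dot_sym// dotC residual_orth//.
exact: (subvP (krylov_sub A b ij)) (residual_krylov i).
Qed.

Section PositiveCurvature.
Context (t : nat).
Hypothesis pos_curv : forall i, (i < t)%N -> 0 < dot (r i) (A *m r i).

(** Conjugate vectors of positive curvature are independent, so by a dimension
    count the residuals form a basis of the Krylov space. *)
Lemma iterate_residuals :
  exists c : 'I_t -> R, p t = \sum_(i < t) c i *: r i.
Proof.
pose X := [tuple r i | i < t].
have Xi (i : 'I_t) : X`_i = r i by rewrite -tnth_nth tnth_mktuple.
have freeX : free X.
  apply/freeP => k /= k0 j.
  have := congr1 (fun v => dot v (A *m r j)) k0.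
  rewrite dot0l dot_suml (bigD1 j)//= big1 => [|i ij]; last first.
    by rewrite Xi dotZl residual_conj ?mulr0.
  rewrite addr0 Xi dotZl => /eqP; rewrite mulf_eq0 => /orP[/eqP //|].
  by rewrite gt_eqF// pos_curv.
have XK : (<<X>> <= krylov A b t)%VS.
  apply/span_subvP => v /mapP[i _ ->].
  exact: (subvP (krylov_sub A b (ltn_ord i))) (residual_krylov i).
have eqK : <<X>>%VS = krylov A b t.
  apply/eqP; rewrite eqEdim XK/= (leq_trans (dim_krylov _ _ _))//.
  by move/eqP : freeX => ->; rewrite size_tuple.
have : p t \in <<X>>%VS by rewrite eqK iterate_krylov.
move=> /coord_span ->; exists (fun i => coord X i (p t)).
by apply: eq_bigr => i _; rewrite Xi.
Qed.

(** Conjugacy isolates the coefficient. *)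
Lemma iterate_coef (c : 'I_t -> R) (i : 'I_t) : p t = \sum_(i < t) c i *: r i ->
  c i * dot (r i) (A *m r i) = norm2 (r i) ^+ 2 - norm2 (r t) ^+ 2.
Proof.
move=> pE; transitivity (dot (r i) (A *m p t)).
  rewrite pE mulmx_sumr dot_sumr (bigD1 i)//= big1 => [|j ji].
    by rewrite addr0 -scalemxAr dotZr.
  by rewrite -scalemxAr dotZr residual_conj ?mulr0// eq_sym.
have -> : A *m p t = r 0 - r t by rewrite residual_diff p0 subr0.
rewrite dotDr dotNr (dotC (r i) (r 0)) !dot_residual//.
by rewrite ltnW.
Qed.

Lemma iterate_coef_ge0 (c : 'I_t -> R) (i : 'I_t) :
  p t = \sum_(i < t) c i *: r i -> 0 <= c i.
Proof.
move=> /(iterate_coef i) ci.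
rewrite -(pmulr_lge0 _ (pos_curv (ltn_ord i))) ci subr_ge0 ler_sqr ?nnegrE ?norm2_ge0//.
by rewrite residual_le// ltnW.
Qed.

(** The iterate is a nonnegative combination of the residuals, and each of them
    has inner product |r_t|^2 with r_t. *)
Lemma iterate_descent : dot (p t) (A *m p t) <= dot b (p t).
Proof.
have [c pE] := iterate_residuals.
have -> : A *m p t = b - r t by rewrite /r opprB addrC subrK.
rewrite dotDr dotNr (dotC b) gerBl {1}pE dot_suml; apply: sumr_ge0 => i _.
rewrite dotZl dot_residual ?(ltnW (ltn_ord i))// mulr_ge0 ?exprn_ge0 ?norm2_ge0//.
exact: iterate_coef_ge0 pE.
Qed.

(** The step from p_i along r_i with the length k / N stays in the Krylov space
    that p_t minimizes over. *)
Lemma residual_decrease (C : R) (i : 'I_t) :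
  (forall v, norm2 (A *m v) <= C * norm2 v) -> 0 < C ->
  dot (r i) (A *m r i) ^+ 2 <=
    C ^+ 2 * norm2 (r i) ^+ 2 * (norm2 (r i) ^+ 2 - norm2 (r t) ^+ 2).
Proof.
move=> AC C0; set k := dot _ _; have k0 : 0 < k := pos_curv (ltn_ord i).
set N := C ^+ 2 * norm2 (r i) ^+ 2.
have ri0 : 0 < norm2 (r i).
  by rewrite norm2_gt0; apply: contraTneq k0; rewrite /k => ->; rewrite dot0l ltxx.
have N0 : 0 < N by rewrite mulr_gt0// exprn_gt0.
have AN : norm2 (A *m r i) ^+ 2 <= N.
  by rewrite /N -exprMn ler_sqr// nnegrE ?norm2_ge0// mulr_ge0 ?norm2_ge0// ltW.
have : norm2 (r t) <= norm2 (b - A *m (p i + (k / N) *: r i)).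
  apply: iterate_min; rewrite memvD ?memvZ//.
    exact: (subvP (krylov_sub A b (ltnW (ltn_ord i)))) (iterate_krylov i).
  exact: (subvP (krylov_sub A b (ltn_ord i))) (residual_krylov i).
rewrite mulmxDr opprD addrA -scalemxAr -/(r i) -ler_sqr ?nnegrE ?norm2_ge0//.
rewrite [X in _ <= X]norm2_sqrB (norm2_sqr (_ *: _)) !(dotZl, dotZr) -/k -norm2_sqr => h.
have : (k / N) ^+ 2 * norm2 (A *m r i) ^+ 2 <= (k / N) ^+ 2 * N.
  by rewrite ler_wpM2l// sqr_ge0.
have -> : (k / N) ^+ 2 * N = k ^+ 2 / N by field; rewrite gt_eqF.
have kk : k / N * k = k ^+ 2 / N by field; rewrite gt_eqF.
rewrite -/N -(ler_pdivrMl _ _ N0) mulrC => h2.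
by move: h; lra.
Qed.

(** If the iterate has curvature at least w, so has one of the residuals it
    combines. The step along that residual reduces the residual norm by the
    factor sqrt (1 - (w / C)^2), and |A p_t|^2 = |b|^2 - |r_t|^2. *)
Lemma iterate_lower (C w : R) : (0 < t)%N -> b != 0 ->
  (forall v, norm2 (A *m v) <= C * norm2 v) -> 0 < C -> 0 <= w ->
  w * norm2 (p t) ^+ 2 <= dot (p t) (A *m p t) ->
  w * norm2 b <= C ^+ 2 * norm2 (p t).
Proof.
move=> t0 b0 AC C0 w0 wp; have [c pE] := iterate_residuals.
have c_ge0 i : 0 <= c i by exact: iterate_coef_ge0 pE.
have b1 : 0 < norm2 b by rewrite norm2_gt0.
have r0E : r 0 = b by exact: residual0.
(* Only a nonzero coefficient makes one of the inequalities below strict. *)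
have c0 : c (Ordinal t0) != 0.
  apply/eqP => c0; have := iterate_coef (Ordinal t0) pE.
  rewrite c0 mul0r => /esym z0.
  have := residual_decrease (Ordinal t0) AC C0; rewrite z0 mulr0.
  by rewrite leNgt exprn_gt0// pos_curv.
have [i wi] : exists i : 'I_t, w * norm2 (r i) ^+ 2 <= dot (r i) (A *m r i).
  apply: contrapT => /forallNP no_i.
  have lt_w (i : 'I_t) : dot (r i) (A *m r i) < w * norm2 (r i) ^+ 2.
    by rewrite ltNge; apply/negP/no_i.
  have : dot (p t) (A *m p t) < w * norm2 (p t) ^+ 2.
    have -> : dot (p t) (A *m p t) = \sum_i c i ^+ 2 * dot (r i) (A *m r i).
      rewrite {1}pE dot_suml; apply: eq_bigr => i _.
      rewrite dotZl pE mulmx_sumr dot_sumr (bigD1 i)//= big1 => [|j ji].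
        by rewrite addr0 -scalemxAr dotZr mulrA.
      by rewrite -scalemxAr dotZr residual_conj ?mulr0// eq_sym.
    apply: (@lt_le_trans _ _ (\sum_i c i ^+ 2 * (w * norm2 (r i) ^+ 2))).
      rewrite (bigD1 (Ordinal t0))//= [ltRHS](bigD1 (Ordinal t0))//=.
      apply: ltr_leD; first by rewrite ltr_pM2l ?exprn_even_gt0//=; exact: (lt_w (Ordinal t0)).
      by apply: ler_sum => i _; rewrite ler_wpM2l ?sqr_ge0//; exact/ltW/lt_w.
    rewrite norm2_sqr {1}pE dot_suml mulr_sumr; apply: ler_sum => i _.
    rewrite mulrCA ler_wpM2l// dotZl expr2 -mulrA ler_wpM2l//.
    rewrite pE dot_sumr (bigD1 i)//= dotZr -norm2_sqr lerDl.
    apply: sumr_ge0 => j _; rewrite dotZr mulr_ge0//.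
    have [ij|ji] := leqP i j; first by rewrite dot_residual// exprn_ge0// norm2_ge0.
    by rewrite dotC dot_residual ?(ltnW ji)// exprn_ge0// norm2_ge0.
  by rewrite ltNge wp.
have := residual_decrease i AC C0.
have ri0 : 0 < norm2 (r i).
  rewrite norm2_gt0; apply: contraTneq (pos_curv (ltn_ord i)) => ->.
  by rewrite dot0l ltxx.
have : (w * norm2 (r i) ^+ 2) ^+ 2 <= dot (r i) (A *m r i) ^+ 2.
  rewrite ler_sqr// nnegrE; first by rewrite mulr_ge0// sqr_ge0.
  by rewrite ltW// pos_curv.
move=> h1 h2; have {h1 h2} := le_trans h1 h2.
move=> h.
have {h} : w ^+ 2 * norm2 (r i) ^+ 2 <= C ^+ 2 * (norm2 (r i) ^+ 2 - norm2 (r t) ^+ 2).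
  have ri2 : 0 < norm2 (r i) ^+ 2 by rewrite exprn_gt0.
  rewrite -(ler_pM2r ri2); move: h; lra.
set x := norm2 (r i); set y := norm2 (r t) => h.
have xb : x ^+ 2 <= norm2 b ^+ 2.
  by rewrite ler_sqr ?nnegrE ?norm2_ge0// /x -r0E residual_le.
have Ap2 : norm2 (A *m p t) ^+ 2 = norm2 b ^+ 2 - y ^+ 2.
  have -> : A *m p t = r 0 - r t by rewrite residual_diff p0 subr0.
  by rewrite norm2_sqrB dot_residual// r0E -/y; ring.
have wb : w ^+ 2 * norm2 b ^+ 2 <= C ^+ 2 * norm2 (A *m p t) ^+ 2.
  rewrite Ap2.
  have y0 : 0 <= C ^+ 2 * y ^+ 2 by rewrite mulr_ge0 ?sqr_ge0.
  have C2 : 0 < C ^+ 2 by rewrite exprn_gt0.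
  have [wC|Cw] := lerP (w ^+ 2) (C ^+ 2).
    have : 0 <= (C ^+ 2 - w ^+ 2) * (norm2 b ^+ 2 - x ^+ 2) by rewrite mulr_ge0 ?subr_ge0.
    by move: h; lra.
  have x2 : 0 < x ^+ 2 by rewrite exprn_gt0.
  have : 0 < (w ^+ 2 - C ^+ 2) * x ^+ 2 by rewrite mulr_gt0// subr_gt0.
  by move: h; lra.
have {wb} : w * norm2 b <= C * norm2 (A *m p t).
  rewrite -ler_sqr ?nnegrE ?mulr_ge0 ?norm2_ge0//; last exact: ltW.
  by rewrite !exprMn.
by move=> /le_trans -> //; rewrite expr2 -mulrA ler_pM2l.
Qed.

End PositiveCurvature.
End MinresIterates.

Section MinresOutput.
Context {R : realType} {n : nat} (A : 'M[R]_n) (b : 'cV[R]_n).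
Hypothesis A_sym : A \is symmetricmx.

(** The direction is a nonnegative multiple of a residual r, and b . r = |r|^2. *)
Lemma minres_NPC tol d : minres A b tol d NPC ->
  dot d (A *m d) <= 0 /\ 0 <= dot b d.
Proof.
move=> [p [p0 p_min /= [t [t0 _]]]]; case: ifPn => [curv [-> _]|_ [_ []]//].
rewrite -scalemxAr !(dotZl, dotZr); set e := norm2 b / _.
have e0 : 0 <= e by rewrite divr_ge0// norm2_ge0.
split; first by rewrite mulr_ge0_le0// mulr_ge0_le0.
rewrite mulr_ge0// -[X in dot X _](residual0 A b p0).
by rewrite (dot_residual p0 p_min)// sqr_ge0.
Qed.

(** Step t tests the curvature of r_(t-1) before it computes p_t, so that all the
    residuals combined in the returned iterate have positive curvature. *)
Lemma minres_SOL tol d : b != 0 -> minres A b tol d SOL ->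
  dot d (A *m d) <= dot b d /\
  forall C w, 0 < C -> 0 <= w -> (forall v, norm2 (A *m v) <= C * norm2 v) ->
    w * norm2 d ^+ 2 <= dot d (A *m d) -> w * norm2 b <= C ^+ 2 * norm2 d.
Proof.
move=> b0 [p [p0 p_min /= [t [t0 before]]]]; case: ifPn => [_ [_]//|curv [_ [-> _]]].
have pos_curv i : (i < t)%N -> 0 < dot (b - A *m p i) (A *m (b - A *m p i)).
  move=> it; have [/(conj (ltn0Sn i))/andP/before|] := ltnP i.+1 t.
    by move=> /andP[+ _]; rewrite -ltNge.
  move=> ti; have -> : i = t.-1 by apply/eqP; rewrite -eqSS prednK// eqn_leq it ti.
  by rewrite ltNge.
split; first exact: iterate_descent pos_curv.
by move=> C w C0 w0 AleC; exact: (iterate_lower A_sym p0 p_min pos_curv t0 b0 AleC C0 w0).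
Qed.

End MinresOutput.

(** * Second-order Taylor bound *)

Section Taylor.
Context {R : realType} {n : nat}.
Implicit Types (f : 'cV[R]_n -> R) (x v : 'cV[R]_n).

Lemma derive_grad f x v : differentiable f x -> 'D_v f x = dot (grad f x) v.
Proof.
move=> df; rewrite deriveE// {1}(matrix_sum_delta v).
under eq_bigr do rewrite big_ord1.
rewrite linear_sum; apply: eq_bigr => i _.
by rewrite linearZ/= -deriveE// mxE mulrC.
Qed.

Lemma differentiable_entry m (F : 'cV[R]_n -> 'cV[R]_m) x j :
  differentiable F x -> differentiable (fun y => F y j 0) x.
Proof.
move=> dF; have /= := differentiable_comp dF (differentiable_coord (F x) j 0).
exact.
Qed.

Lemma is_derive_line f x v (t : R) : derivable f (x + t *: v) v ->
  is_derive t 1 (fun s : R => f (x + s *: v)) ('D_v f (x + t *: v)).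
Proof.
have E : (fun h : R => h^-1 *: ((fun s : R => f (x + s *: v)) (h *: 1 + t) - f (x + t *: v)))
       = (fun h : R => h^-1 *: (f (h *: v + (x + t *: v)) - f (x + t *: v))).
  apply/funext => h; have -> // : x + (h *: 1 + t) *: v = h *: v + (x + t *: v).
  by rewrite scalerDl addrCA [h *: 1]mulr1.
move=> df; split; first by rewrite /derivable /= E.
by rewrite [LHS]/derive /= E.
Qed.

Lemma derive_grad_line f x v (t : R) :
  differentiable (grad f) (x + t *: v) ->
  is_derive t 1 (fun s : R => dot (grad f (x + s *: v)) v)
    (dot v (hess f (x + t *: v) *m v)).
Proof.
move=> dg; set y := x + t *: v.
pose F (z : 'cV[R]_n) := dot (grad f z) v.
have dj j : differentiable (fun z => grad f z j 0) y by exact: differentiable_entry.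
have dF : differentiable F y.
  have -> : F = \sum_(j < n) (fun z => grad f z j 0 * v j 0).
    by apply/funext => z; rewrite fct_sumE.
  by apply: differentiable_sum => j; apply: differentiableM.
have -> : dot v (hess f y *m v) = 'D_v F y.
  rewrite derive_grad//.
  rewrite dotC; apply: eq_bigr => i _; congr (_ * _).
  rewrite mxE mxE /F.
  have -> : (fun z => dot (grad f z) v) = \sum_(j < n) (v j 0 \*: (fun z => grad f z j 0)).
    by apply/funext => z; rewrite fct_sumE; apply: eq_bigr => j _; rewrite mulrC.
  rewrite derive_sum => [|j]; last by apply: derivableZ; exact: diff_derivable.
  apply: eq_bigr => j _; rewrite deriveZ; last exact: diff_derivable.
  by rewrite mxE mulrC.
exact/is_derive_line/diff_derivable.
Qed.

(** Only an upper bound on the curvature along the segment enters, so that this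
    serves for a bounded and for a Lipschitz Hessian. *)
Lemma taylor2_le f x v M :
  (forall y, differentiable f y) -> (forall y, differentiable (grad f) y) ->
  (forall s : R, 0 <= s <= 1 -> dot v (hess f (x + s *: v) *m v) <= M) ->
  f (x + v) <= f x + dot (grad f x) v + M / 2.
Proof.
move=> df dg HM.
pose g (s : R) := dot (grad f (x + s *: v)) v.
have g' (s : R) : is_derive s 1 g (dot v (hess f (x + s *: v) *m v)) by exact: derive_grad_line.
have gb (s : R) : 0 <= s <= 1 -> g s <= g 0 + M * s.
  move=> /andP[s0 s1]; have [->|sn0] := eqVneq s 0; first by rewrite mulr0 addr0.
  have sp : 0 < s by rewrite lt_def sn0.
  have [c /andP[c0 cs] gc] : exists2 c, c \in `]0, s[ &
     g s - g 0 = dot v (hess f (x + c *: v) *m v) * (s - 0).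
    apply: MVT => //; apply: derivable_within_continuous => y _; exact: ex_derive.
  rewrite -lerBlDl gc subr0 ler_wpM2r// HM//.
  by move: c0 cs; rewrite !bnd_simp => c0 cs; apply/andP; split; lra.
pose h (s : R) := f (x + s *: v) - (M / 2) * s ^+ 2.
have h' (s : R) : is_derive s 1 h (g s - M * s).
  have h1 : is_derive s 1 (fun s : R => f (x + s *: v)) (g s).
    rewrite /g -derive_grad//; exact/is_derive_line/diff_derivable.
  have h2 : is_derive s 1 (fun s : R => (M / 2) * s ^+ 2) (M * s).
    apply: is_derive_eq.
    by rewrite /GRing.scale /=; field.
  exact: is_deriveB.
have [c /andP[c0 c1] hc] : exists2 c, c \in `]0, 1[ & h 1 - h 0 = (g c - M * c) * (1 - 0).
  apply: MVT => //; apply: derivable_within_continuous => y _; exact: ex_derive.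
have c01 : 0 <= c <= 1 by move: c0 c1; rewrite !bnd_simp => c0 c1; apply/andP; split; lra.
move: hc (gb _ c01); rewrite /h /g !scale0r !scale1r !addr0 !expr1n expr0n/= => hc gc.
by lra.
Qed.

End Taylor.

(** * One iteration of the method *)

Section Iteration.
Context {R : realType} {n : nat} (P : minres_params R).
Local Notation rho := (ls_rho P).
Local Notation sigma := (ls_sigma P).

Let rho0 : 0 < rho. Proof. by case/andP: (ls_rho_range P). Qed.
Let rho1 : rho < 1. Proof. by case/andP: (ls_rho_range P). Qed.
Let sigma0 : 0 < sigma. Proof. by case/andP: (ls_sigma_range P). Qed.
Let sigma1 : sigma < 1. Proof. by case/andP: (ls_sigma_range P). Qed.
Let s0 : 0 < ls_s P. Proof. exact: ls_s_gt0. Qed.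

(** The curvature per squared length below which the method falls back to the
    negative gradient. *)
Definition curvature_threshold k (g : 'cV[R]_n) : R :=
  Num.min (ls_capA P) (ls_a P k * norm2 g `^ ls_alpha P).

Lemma ls_a_gt0 k : 0 < ls_a P k.
Proof. by have [abar abar0 /(_ k)] := ls_a_lower P; apply: lt_le_trans. Qed.

Lemma curvature_threshold_ge0 k g : 0 <= curvature_threshold k g.
Proof.
rewrite le_min; have /andP[/ltW -> _] := ls_capA_range P.
by rewrite mulr_ge0 ?powR_ge0// ltW// ls_a_gt0.
Qed.

Lemma curvature_threshold_le1 k g : curvature_threshold k g <= 1.
Proof. by rewrite ge_min; have /andP[_ ->] := ls_capA_range P. Qed.

Lemma direction_NPC k g Bb (d : 'cV[R]_n) :
  direction_step P k g Bb d NPC -> dot d (Bb *m d) <= 0 /\ dot g d <= 0.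
Proof.
move=> [d' [fl' [out /=]]]; case: ifPn => [_ [_ //]|_ [-> flE]].
rewrite -flE in out; have [-> ] := minres_NPC out.
by rewrite dotNl oppr_ge0.
Qed.

(** The negative gradient satisfies both bounds because the threshold is at most
    1; for an iterate they are the two properties of MINRES output. *)
Lemma direction_descent k g Bb (d : 'cV[R]_n) fl : Bb \is symmetricmx -> g != 0 ->
  fl <> NPC -> direction_step P k g Bb d fl ->
  let w := curvature_threshold k g in
  w * norm2 d ^+ 2 <= - dot g d /\
  forall C, 1 <= C -> (forall v, norm2 (Bb *m v) <= C * norm2 v) ->
    w * norm2 g <= C ^+ 2 * norm2 d.
Proof.
move=> sB g0 flN [d' [fl' [out /=]]]; case: ifPn => [_ [-> _]|big [-> flE]];
  set w := curvature_threshold k g.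
  have w1 : w <= 1 := curvature_threshold_le1 k g.
  split; first by rewrite dotNr opprK norm2N norm2_sqr ler_piMl ?dot_ge0.
  move=> C C1 _; rewrite norm2N ler_wpM2r ?norm2_ge0// (le_trans w1)//.
  by rewrite expr_ge1// (le_trans _ C1).
have {}flE : fl' = SOL.
  case: fl' out flE {big} => // -[p [_ _ /= [t [_ _]]]].
  by case: ifP => _; [case|case=> _ []].
rewrite flE in out big; move: big; rewrite /= -leNgt => big.
have Ng0 : - g != 0 by rewrite oppr_eq0.
have [desc low] := minres_SOL sB Ng0 out.
split; first by rewrite -dotNl (le_trans big).
move=> C C1 BC; rewrite -[norm2 g]norm2N low//; first exact: lt_le_trans C1.
exact: curvature_threshold_ge0.
Qed.

Section Stepsize.
Context (f : 'cV[R]_n -> R) (x d : 'cV[R]_n) (B : 'M[R]_n).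

Lemma stepsize_armijo fl l : fl <> NPC -> stepsize P f x d B fl l ->
  [/\ 0 < l <= ls_s P, armijo P f x d l & l = ls_s P \/ ~ armijo P f x d (l / rho)].
Proof.
move=> flN; have {flN} : stepsize P f x d B fl l -> backward_linesearch P 0 (armijo P f x d) l.
  by case: fl flN.
move=> /[apply] -[j [_ -> Cj jmin]]; split => //.
  rewrite mulr_gt0 ?exprn_gt0//= ler_piMr ?(ltW s0)//.
  by rewrite exprn_ile1// ltW.
case: j Cj jmin => [|j] Cj jmin; first by left; rewrite expr0 mulr1.
right; rewrite exprSr mulrA mulfK ?gt_eqF// => Cj1.
by have := jmin j (leq0n _) Cj1; rewrite ltnn.
Qed.

(** In both linesearches of a negative curvature step the acceptance test fails
    for the next longer step, which forces the step to be long. *)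
Lemma stepsize_NPC l : stepsize P f x d B NPC l ->
  [/\ 0 < l, armijo_npc P f x d B l & ~ armijo_npc P f x d B (l / rho)].
Proof.
move=> [[Ns [j [j0 -> Cj jmin]]]|[Cs [j [-> okj jmax]]]].
  split => //; first by rewrite mulr_gt0 ?exprn_gt0.
  case: j j0 Cj jmin => // j _ Cj jmin.
  rewrite exprSr mulrA mulfK ?gt_eqF//.
  case: j Cj jmin => [|j] Cj jmin; first by rewrite expr0 mulr1.
  by move=> /(jmin j.+1 isT); rewrite ltnn.
split; [by rewrite mulr_gt0 ?invr_gt0 ?exprn_gt0|exact: okj|].
have -> : ls_s P * rho ^- j / rho = ls_s P * rho ^- j.+1.
  by rewrite exprSr invfM mulrA.
move=> Cj1; have : (j.+1 <= j)%N.
  apply: jmax => i; rewrite leq_eqVlt => /orP[/eqP -> //|]; rewrite ltnS.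
  exact: okj.
by rewrite ltnn.
Qed.

Lemma armijo_le fl l : fl <> NPC -> dot (grad f x) d <= 0 ->
  stepsize P f x d B fl l -> f (x + l *: d) <= f x.
Proof.
move=> flN gd /(stepsize_armijo flN)[/andP[l0 _] + _].
rewrite /armijo dotC => h; rewrite -subr_le0 (le_trans h)//.
by rewrite mulr_ge0_le0// mulr_ge0// ltW.
Qed.

End Stepsize.

Section LocalBounds.
Context (f : 'cV[R]_n -> R) (r M L : R) (x d : 'cV[R]_n).
Hypothesis df : forall y, differentiable f y.
Hypothesis dg : forall y, differentiable (grad f) y.
Hypothesis M1 : 1 <= M.
Hypothesis L0 : 0 < L.
Hypothesis hess_bounded : forall y v, norm2 (y - x) < r ->
  norm2 (hess f y *m v) <= M * norm2 v.
Hypothesis hess_lip : forall y v, norm2 (y - x) < r ->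
  norm2 ((hess f y - hess f x) *m v) <= L * norm2 (y - x) * norm2 v.

Lemma segment_in_ball u (t : R) : norm2 u < r -> 0 <= t <= 1 ->
  norm2 (x + t *: u - x) <= norm2 u /\ norm2 (x + t *: u - x) < r.
Proof.
move=> ur /andP[t0 t1]; rewrite addrAC subrr add0r norm2Z ger0_norm//.
have h : t * norm2 u <= norm2 u by rewrite ler_piMl ?norm2_ge0.
by split => //; apply: le_lt_trans ur.
Qed.

Lemma taylor_bounded u : norm2 u < r ->
  f (x + u) <= f x + dot (grad f x) u + M * norm2 u ^+ 2 / 2.
Proof.
move=> ur; apply: taylor2_le => // t t01.
have [_ tr] := segment_in_ball ur t01.
rewrite (le_trans (CauchySchwarz_dot _ _))//.
rewrite expr2 mulrCA ler_wpM2l ?norm2_ge0//; exact: hess_bounded.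
Qed.

Lemma taylor_lipschitz u : norm2 u < r ->
  f (x + u) <= f x + dot (grad f x) u +
    (dot u (hess f x *m u) + L * norm2 u * norm2 u ^+ 2) / 2.
Proof.
move=> ur; apply: taylor2_le => // t t01.
have [tu tr] := segment_in_ball ur t01.
rewrite -lerBlDl -dotNr -dotDr -mulmxBl (le_trans (CauchySchwarz_dot _ _))//.
rewrite expr2 mulrCA ler_wpM2l ?norm2_ge0//.
rewrite (le_trans (hess_lip _ tr))// ler_wpM2r ?norm2_ge0// ler_wpM2l//.
exact: ltW.
Qed.

(** At a rejected step the quadratic remainder outweighs the directional
    derivative, so the step is at least a multiple of the threshold; or the
    rejected step leaves the ball. *)
Lemma step_lower_descent k fl Bk l : fl <> NPC ->
  let w := curvature_threshold k (grad f x) in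
  w * norm2 d ^+ 2 <= - dot (grad f x) d -> stepsize P f x d Bk fl l ->
  Num.min (ls_s P) (rho * (1 - sigma) / M) * w <= l \/ rho * r <= l * norm2 d.
Proof.
move=> flN w wd /(stepsize_armijo flN)[/andP[l0 _] _ lE].
have w0 : 0 <= w := curvature_threshold_ge0 k _.
have w1 : w <= 1 := curvature_threshold_le1 k _.
have M0 : 0 < M by exact: lt_le_trans M1.
case: lE => [->|Nar].
  left; have : Num.min (ls_s P) (rho * (1 - sigma) / M) <= ls_s P by rewrite ge_min lexx.
  move=> le_c; rewrite (le_trans (ler_wpM2r w0 le_c))//.
  by rewrite ler_piMr// ltW.
have lr0 : 0 < l / rho by rewrite divr_gt0.
have [far|near] := leP r (norm2 ((l / rho) *: d)).
  right; move: far; rewrite norm2Z (gtr0_norm lr0) mulrAC.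
  by rewrite ler_pdivlMr// mulrC.
left; have := taylor_bounded near; rewrite dotZr norm2Z (gtr0_norm lr0) => T.
move/negP: Nar; rewrite /armijo -ltNge dotC => A.
set m := l / rho in lr0 T A *.
set D := norm2 d in wd T A *; set G := dot _ d in wd T A *.
have h1 : m * ((1 - sigma) * - G) < m * (M * m * D ^+ 2).
  have : 0 <= M * (m ^+ 2 * D ^+ 2) by rewrite mulr_ge0 ?(ltW M0)// mulr_ge0 ?sqr_ge0.
  by move: T A; rewrite exprMn; lra.
rewrite ltr_pM2l// in h1.
have s1 : 0 < 1 - sigma by rewrite subr_gt0.
have h2 : (1 - sigma) * (w * D ^+ 2) < M * m * D ^+ 2.
  by rewrite (le_lt_trans _ h1)// ler_wpM2l// ltW.
have h3 : (1 - sigma) * w < M * m.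
  have [D0|D0] := eqVneq (D ^+ 2) 0; first by rewrite D0 !mulr0 ltxx in h2.
  have Dp : 0 < D ^+ 2 by rewrite lt_def D0 sqr_ge0.
  by rewrite -(ltr_pM2r Dp) -mulrA.
have -> : l = rho * m by rewrite /m mulrC divfK// gt_eqF.
have : Num.min (ls_s P) (rho * (1 - sigma) / M) <= rho * (1 - sigma) / M.
  by rewrite ge_min lexx orbT.
move=> le_c; rewrite (le_trans (ler_wpM2r w0 le_c))//.
have -> : rho * (1 - sigma) / M * w = rho * ((1 - sigma) * w / M).
  by field; rewrite gt_eqF.
by rewrite ler_pM2l// ler_pdivrMr// [m * M]mulrC ltW.
Qed.

(** The curvature of d is at most -z. At a rejected step the cubic remainder
    outweighs it, so the step is at least a multiple of z / L; or the rejected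
    step leaves the ball, where z <= Z makes its length at least a multiple of z. *)
Lemma step_NPC l z Z : 0 <= z -> z <= Z -> 0 < Z -> 0 < r ->
  dot d ((hess f x + z%:M) *m d) <= 0 -> dot (grad f x) d <= 0 ->
  stepsize P f x d (hess f x) NPC l ->
  let D := norm2 (l *: d) in
  rho * Num.min (r / Z) ((1 - sigma) / L) * z <= D /\
  sigma / 2 * z * D ^+ 2 <= f x - f (x + l *: d).
Proof.
move=> z0 zZ Z0 r0; rewrite mulmxDl mul_scalar_mx dotDr dotZr -norm2_sqr => curv gd.
move=> /stepsize_NPC[l0 C NC]; set c := Num.min _ _; move=> D.
have DE : D = l * norm2 d by rewrite /D norm2Z gtr0_norm.
have c0 : 0 <= c.
  by rewrite le_min !divr_ge0 ?subr_ge0// ltW.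
split; last first.
  have h1 : sigma * l * dot (grad f x) d <= 0 by rewrite mulr_ge0_le0// mulr_ge0// ltW.
  have : 0 <= (sigma / 2 * l ^+ 2) * - (dot d (hess f x *m d) + z * norm2 d ^+ 2).
    by rewrite mulr_ge0 ?oppr_ge0// mulr_ge0 ?sqr_ge0// divr_ge0// ltW.
  by move: C h1; rewrite /armijo_npc DE; lra.
have lr0 : 0 < l / rho by rewrite divr_gt0.
have [far|near] := leP r (norm2 ((l / rho) *: d)).
  have h : rho * r <= D.
    move: far; rewrite norm2Z (gtr0_norm lr0) mulrAC.
    by rewrite ler_pdivlMr// mulrC DE.
  apply: le_trans h; rewrite -mulrA ler_pM2l//.
  have : c <= r / Z by rewrite ge_min lexx.
  rewrite ler_pdivlMr// => h; apply: le_trans h.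
  by rewrite ler_wpM2l.
have := taylor_lipschitz near.
rewrite -scalemxAr dotZl !dotZr norm2Z (gtr0_norm lr0) => T.
move/negP: NC; rewrite /armijo_npc -ltNge => A.
set m := l / rho in lr0 T A *.
set G := dot _ d in gd T A *; set H := dot d _ in curv T A *.
have -> : D = rho * (m * norm2 d).
  by rewrite DE mulrA /m [rho * _]mulrC divfK// gt_eqF.
set E := norm2 d in curv T A *.
have s1 : 0 < 1 - sigma by rewrite subr_gt0.
have h1 : m ^+ 2 * ((1 - sigma) * (z * E ^+ 2)) < m ^+ 2 * (L * (m * E) * E ^+ 2).
  have : 0 <= (1 - sigma) * (m * - G) by rewrite mulr_ge0 ?(ltW s1)// mulr_ge0 ?oppr_ge0// ltW.
  have : 0 <= (1 - sigma) * (m ^+ 2 * - (H + z * E ^+ 2)).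
    by rewrite mulr_ge0 ?(ltW s1)// mulr_ge0 ?sqr_ge0// oppr_ge0.
  by move: T A; lra.
rewrite ltr_pM2l ?exprn_gt0// in h1.
have h3 : (1 - sigma) * z < L * (m * E).
  have [D0|D0] := eqVneq (E ^+ 2) 0; first by rewrite D0 !mulr0 ltxx in h1.
  have Dp : 0 < E ^+ 2 by rewrite lt_def D0 sqr_ge0.
  by rewrite -(ltr_pM2r Dp) -mulrA.
rewrite -mulrA ler_pM2l//.
have : c <= (1 - sigma) / L by rewrite ge_min lexx orbT.
move=> le_c; rewrite (le_trans (ler_wpM2r z0 le_c))//.
by rewrite mulrAC ler_pdivrMr// [_ * L]mulrC ltW.
Qed.

End LocalBounds.
End Iteration.

(** * Real sequences *)

Section Powers.
Context {R : realType}.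
Implicit Types (e s t b m k : R).

Lemma powR_le0_ge1 e t : 0 < e <= 1 -> t <= 0 -> 1 <= e `^ t.
Proof. by move=> e01 t0; rewrite -[leLHS](powRr0 e) ger_powR. Qed.

Lemma powR_le0_le1 k t : 1 <= k -> t <= 0 -> k `^ t <= 1.
Proof. by move=> k1 t0; rewrite -[leRHS](powRr0 k) ler_powR. Qed.

(** Young's inequality at s / t. *)
Lemma powR_concave b s t : 0 < b < 1 -> 0 <= s <= t -> 0 < t ->
  b * t `^ (b - 1) * (t - s) <= t `^ b - s `^ b.
Proof.
move=> /andP[b0 b1] /andP[s0 st] t0.
have ut : s = (s / t) * t by rewrite divfK// gt_eqF.
have u0 : 0 <= s / t by rewrite divr_ge0// ltW.
set u := s / t in ut u0.
have bn0 : 1 - b != 0 by rewrite subr_eq0 gt_eqF.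
have b'0 : 0 < (1 - b)^-1 by rewrite invr_gt0 subr_gt0.
have bi0 : 0 < b^-1 by rewrite invr_gt0.
have sum1 : b^-1^-1 + (1 - b)^-1^-1 = 1 by rewrite !invrK addrC subrK.
have := conjugate_powR (powR_ge0 u b) ler01 bi0 b'0 sum1.
rewrite -powRrM mulfV ?gt_eqF// powRr1// powR1 mulr1 !invrK mul1r => h.
have -> : s `^ b = u `^ b * t `^ b by rewrite {1}ut powRM// ltW.
have -> : t `^ (b - 1) = t `^ b / t.
  by rewrite powRB ?(gt_eqF t0) ?implybT// powRr1// ltW.
have -> : b * (t `^ b / t) * (t - s) = t `^ b * (b * (1 - u)).
  by rewrite {1}ut; field; rewrite gt_eqF.
have -> : t `^ b - u `^ b * t `^ b = t `^ b * (1 - u `^ b) by ring.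
rewrite ler_wpM2l ?powR_ge0//; lra.
Qed.

(** The exponent (1 - theta) / 2 lies strictly below the exponent 1 - theta of
    the desingularizing function; the slack pays for the finite length as well
    as for the rate of decay in the next lemma. *)
Lemma lojasiewicz_length (theta kappa c e e' g D : R) :
  let b := (1 - theta) / 2 in
  0 <= theta < 1 -> 0 < kappa -> 0 < c -> 0 < g -> 0 <= D ->
  0 <= e' <= e -> e <= 1 -> (0 < e -> kappa * e `^ theta <= g) ->
  c * g * D <= e - e' -> D <= (b * c * kappa)^-1 * (e `^ b - e' `^ b).
Proof.
move=> b /andP[th0 th1] k0 c0 g0 D0 ee' e1 loj dec.
have b0 : 0 < b by rewrite divr_gt0// subr_gt0.
have b1 : b < 1 by rewrite /b; lra.
have bE : b = (1 - theta) / 2 by []; clearbody b.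
have [e0|e0] := ltP 0 e; last first.
  have /andP[e'0 e'e] := ee'.
  have e0' : e = 0 by apply/le_anti; rewrite e0 (le_trans e'0 e'e).
  have e'0' : e' = 0 by apply/le_anti; rewrite e'0 -e0' e'e.
  move: dec; rewrite e0' e'0' !subrr mulr0; rewrite pmulr_rle0// mulr_gt0//.
have := @powR_concave b e' e; rewrite b0 b1 => /(_ isT ee' e0) h.
rewrite ler_pdivlMl; last exact: mulr_gt0 (mulr_gt0 b0 c0) k0.
apply: le_trans h.
have e_pos : 0 < e `^ (b - 1) by rewrite powR_gt0.
have h1 : b * e `^ (b - 1) * (c * g * D) <= b * e `^ (b - 1) * (e - e').
  by rewrite ler_wpM2l// mulr_ge0// ltW.
apply: le_trans h1.
have h2 : kappa <= e `^ (b - 1) * g.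
  apply: (@le_trans _ _ (e `^ (b - 1) * (kappa * e `^ theta))); last first.
    by rewrite ler_wpM2l ?(ltW e_pos)//; exact: loj.
  rewrite mulrCA -powRD; last by rewrite (gt_eqF e0) implybT.
  rewrite ler_peMr ?(ltW k0)//.
  by apply: powR_le0_ge1; [rewrite e0|rewrite bE; lra].
have : 0 <= (b * c * D) * (e `^ (b - 1) * g - kappa).
  by rewrite mulr_ge0 ?subr_ge0// !mulr_ge0// ltW.
lra.
Qed.

(** Since 1 - b >= theta (1 + b), the factor e^(b - 1) gained from the concavity
    of the power dominates g^-(1 + b); the exponent of g drops from 2 to 1 - b,
    which is below 1. *)
Lemma lojasiewicz_rate (theta kappa c e e' g W : R) :
  let b := (1 - theta) / 2 in
  0 <= theta < 1 -> 0 < kappa -> 0 < c -> 0 < g -> 0 <= W ->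
  0 <= e' <= e -> 0 < e <= 1 -> kappa * e `^ theta <= g ->
  c * W * g ^+ 2 <= e - e' ->
  b * c * kappa `^ (1 + b) * (W * g `^ (1 - b)) <= e `^ b - e' `^ b.
Proof.
move=> b /andP[th0 th1] k0 c0 g0 W0 ee' /andP[e0 e1] loj dec.
have b0 : 0 < b by rewrite divr_gt0// subr_gt0.
have b1 : b < 1 by rewrite /b; lra.
have bE : b = (1 - theta) / 2 by []; clearbody b.
have := @powR_concave b e' e; rewrite b0 b1 => /(_ isT ee' e0) h.
apply: le_trans h.
have h1 : b * e `^ (b - 1) * (c * W * g ^+ 2) <= b * e `^ (b - 1) * (e - e').
  by rewrite ler_wpM2l// mulr_ge0 ?powR_ge0// ltW.
apply: le_trans h1.
have h2 : kappa `^ (1 + b) * g `^ (1 - b) <= e `^ (b - 1) * g ^+ 2.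
  have -> : g `^ (1 - b) = g `^ (- (1 + b)) * g ^+ 2.
    rewrite -powR_mulrn ?(ltW g0)// -powRD; last by rewrite (gt_eqF g0) implybT.
    by congr (_ `^ _); lra.
  rewrite mulrA ler_wpM2r ?sqr_ge0//.
  rewrite powRN ler_pdivrMr ?powR_gt0//.
  apply: (@le_trans _ _ (e `^ (b - 1) * (kappa * e `^ theta) `^ (1 + b))); last first.
    rewrite ler_wpM2l ?powR_ge0// ge0_ler_powR ?nnegrE//.
    - by lra.
    - by rewrite mulr_ge0 ?powR_ge0// ltW.
    - exact: ltW.
  rewrite powRM ?powR_ge0 ?(ltW k0)// mulrCA ler_peMr ?powR_ge0//.
  rewrite -powRrM -powRD; last by rewrite (gt_eqF e0) implybT.
  apply: powR_le0_ge1; first by rewrite e0.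
  rewrite -oppr_ge0.
  have -> : - (b - 1 + theta * (1 + b)) = b * (1 - theta) by rewrite bE; field.
  by rewrite mulr_ge0 ?(ltW b0)// subr_ge0 ltW.
have : 0 <= (b * c * W) * (e `^ (b - 1) * g ^+ 2 - kappa `^ (1 + b) * g `^ (1 - b)).
  by rewrite mulr_ge0 ?subr_ge0// !mulr_ge0// ltW.
lra.
Qed.

Lemma threshold_powR (a alpha m : R) : 0 < a -> 0 < alpha -> 0 <= m ->
  a * m `^ alpha = (m / a `^ (- alpha^-1)) `^ alpha.
Proof.
move=> a0 al0 m0; rewrite powRN invrK powRM ?powR_ge0// -powRrM mulVf ?gt_eqF//.
by rewrite powRr1 ?(ltW a0)// mulrC.
Qed.

(** Either the summable term dominates 1 / k, or a is so large that the
    threshold is bounded below by a small negative power of k. *)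
Lemma harmonic_le (A alpha b c a m k : R) :
  0 < A <= 1 -> 0 < alpha <= 1 -> 0 < b < 1 -> 0 < c <= 1 -> 0 < a -> 1 <= k ->
  c * k `^ (- (1 + b / 5)) <= m ->
  k^-1 <= (A ^+ 4 * c ^+ 5)^-1 * (Num.min A (a * m `^ alpha) ^+ 4 * m `^ (1 - b))
    + a `^ (- alpha^-1).
Proof.
move=> /andP[A0 A1] /andP[al0 al1] /andP[b0 b1] /andP[c0 c1] a0 k1 cm.
have k0 : 0 < k by exact: lt_le_trans k1.
set W := Num.min _ _; set u := a `^ _.
have u0 : 0 < u by rewrite powR_gt0.
have K0 : 0 < A ^+ 4 * c ^+ 5 by rewrite mulr_gt0// exprn_gt0.
have W0 : 0 <= W by rewrite le_min (ltW A0) mulr_ge0 ?powR_ge0// ltW.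
have m0 : 0 < m by apply: lt_le_trans cm; rewrite mulr_gt0// powR_gt0.
have [uk|ku] := leP k^-1 u.
  by rewrite ler_wpDl// mulr_ge0 ?invr_ge0 ?(ltW K0)// mulr_ge0 ?powR_ge0// exprn_ge0.
rewrite ler_wpDr ?(ltW u0)//.
rewrite ler_pdivlMl//.
pose q : R := k `^ (- (b / 5)).
have q0 : 0 < q by rewrite powR_gt0.
have q1 : q <= 1.
  by apply: powR_le0_le1 => //; rewrite oppr_le0 divr_ge0// ltW.
have cq1 : c * q <= 1 by rewrite mulr_ile1// ltW.
have am : c * q <= a * m `^ alpha.
  have cqu : c * q <= m / u.
    rewrite ler_pdivlMr//; apply: le_trans cm.
    have -> : c * k `^ (- (1 + b / 5)) = c * q * k^-1.
      rewrite opprD powRD; last by rewrite (gt_eqF k0) implybT.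
      by rewrite powR_inv1 ?(ltW k0)// mulrA mulrAC.
    by rewrite ler_wpM2l ?(ltW ku)// mulr_ge0// ltW.
  rewrite threshold_powR ?(ltW m0)// -/u.
  apply: (@le_trans _ _ ((c * q) `^ alpha)).
    by rewrite ger1_powR// cq1 mulr_gt0.
  by rewrite ge0_ler_powR ?nnegrE ?(ltW al0) ?mulr_ge0 ?invr_ge0// ltW.
have AW : A * c * q <= W.
  rewrite le_min -mulrA ler_piMr ?(ltW A0)//=; apply: le_trans am.
  by rewrite ler_piMl// mulr_ge0// ltW.
have Am : c * (k `^ (- (1 + b / 5))) `^ (1 - b) <= m `^ (1 - b).
  apply: (@le_trans _ _ ((c * k `^ (- (1 + b / 5))) `^ (1 - b))).
    rewrite powRM ?powR_ge0 ?(ltW c0)// ler_wpM2r ?powR_ge0//.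
    by rewrite ger1_powR ?c0//; lra.
  by rewrite ge0_ler_powR ?nnegrE ?(ltW m0) ?mulr_ge0 ?powR_ge0 ?(ltW c0)//; lra.
apply: (@le_trans _ _ ((A * c * q) ^+ 4 * (c * (k `^ (- (1 + b / 5))) `^ (1 - b)))); last first.
  rewrite ler_pM//.
  - by rewrite exprn_ge0// !mulr_ge0// ltW.
  - by rewrite mulr_ge0 ?powR_ge0// ltW.
  - by rewrite lerXn2r// nnegrE// !mulr_ge0// ltW.
have -> : (A * c * q) ^+ 4 * (c * (k `^ (- (1 + b / 5))) `^ (1 - b)) =
   A ^+ 4 * c ^+ 5 * (q ^+ 4 * (k `^ (- (1 + b / 5))) `^ (1 - b)) by ring.
rewrite ler_pM2l// -powR_inv1 ?(ltW k0)//.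
rewrite -(powR_mulrn 4 (ltW q0)) /q -!powRrM -powRD; last by rewrite (gt_eqF k0) implybT.
rewrite ler_powR//.
(* The exponent b / 5 is chosen so that 4 b / 5 + (1 + b / 5) (1 - b) <= 1. *)
have := mulr_ge0 (ltW b0) (ltW b0).
by lra.
Qed.

Lemma ln_sqr_le k e : 1 <= k -> 0 < e -> ln k ^+ 2 <= (2 / e) ^+ 2 * k `^ e.
Proof.
move=> k1 e0; have k0 : 0 < k by exact: lt_le_trans k1.
have -> : k `^ e = (k `^ (e / 2)) ^+ 2.
  by rewrite -powR_mulrn ?powR_ge0// -powRrM divfK.
have h : ln k <= 2 / e * k `^ (e / 2).
  have := ln_sublinear (powR_gt0 (e / 2) k0); rewrite ln_powR => /ltW h.
  rewrite -ler_pdivrMl ?divr_gt0// invf_div; exact: h.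
rewrite -exprMn ler_sqr ?nnegrE ?ln_ge0//.
by rewrite !mulr_ge0 ?powR_ge0 ?invr_ge0// ltW.
Qed.

(** Growth of z at most k log(k)^2 to the power zeta: a regularization bounded
    below forces the gradient to decay no faster than almost 1 / k. *)
Lemma gradient_lower (zeta C delta e : R) : 0 < zeta -> 0 < C -> 0 < delta -> 0 < e ->
  exists2 c, 0 < c <= 1 & forall k m z, 1 <= k -> 0 <= m ->
    `|z| <= C * `|(k * ln k ^+ 2) `^ zeta| -> delta <= z * m `^ zeta ->
    c * k `^ (- (1 + e)) <= m.
Proof.
move=> ze0 C0 de0 e0.
pose c0 := (delta / C) `^ zeta^-1 / (2 / e) ^+ 2.
have c00 : 0 < c0 by rewrite divr_gt0 ?powR_gt0 ?exprn_gt0 ?divr_gt0.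
exists (Num.min 1 c0) => [|k m z k1 m0 zC dz].
  by rewrite lt_min ltr01 c00 ge_min lexx.
have k0 : 0 < k by exact: lt_le_trans k1.
have lnk0 : 0 <= ln k by exact: ln_ge0.
apply: (@le_trans _ _ (c0 * k `^ (- (1 + e)))).
  by rewrite ler_wpM2r ?powR_ge0// ge_min lexx orbT.
rewrite powRN ler_pdivrMr ?powR_gt0//.
rewrite /c0 ler_pdivrMr; last by rewrite exprn_gt0// divr_gt0.
pose K := m * k `^ (1 + e) * (2 / e) ^+ 2.
have K0 : 0 <= K by rewrite mulr_ge0 ?sqr_ge0// mulr_ge0 ?powR_ge0.
have dK : delta / C <= K `^ zeta.
  rewrite ler_pdivrMr// mulrC (le_trans dz)//.
  rewrite (ger0_norm (powR_ge0 _ _)) in zC.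
  have : z * m `^ zeta <= C * (k * ln k ^+ 2) `^ zeta * m `^ zeta.
    by rewrite ler_wpM2r ?powR_ge0// (le_trans (ler_norm z)).
  move=> /le_trans-> //; rewrite -mulrA ler_pM2l// -powRM ?mulr_ge0 ?sqr_ge0 ?(ltW k0)//.
  apply: ge0_ler_powR; rewrite ?nnegrE ?(ltW ze0)//.
    by rewrite mulr_ge0// mulr_ge0 ?sqr_ge0 ?(ltW k0).
  rewrite /K powRD; last by rewrite (gt_eqF k0) implybT.
  rewrite powRr1 ?(ltW k0)//.
  have -> : m * (k * k `^ e) * (2 / e) ^+ 2 = (m * k) * ((2 / e) ^+ 2 * k `^ e) by ring.
  rewrite mulrAC [k * m]mulrC ler_wpM2l ?mulr_ge0 ?(ltW k0)//.
  exact: ln_sqr_le.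
rewrite -/K; have -> : K = K `^ zeta `^ zeta^-1 by rewrite -powRrM mulfV ?gt_eqF// powRr1.
by rewrite ge0_ler_powR ?nnegrE ?powR_ge0 ?invr_ge0 ?(ltW ze0)// ltW// divr_gt0.
Qed.

End Powers.

Section Sequences.
Context {R : realType}.
Implicit Types u D W : nat -> R.

Lemma powR_cvg_to0 (u : nat -> R) (b : R) : (forall k, 0 <= u k) -> 0 < b ->
  u @ \oo --> 0 -> (fun k => u k `^ b) @ \oo --> 0.
Proof.
move=> u0 b0 ulim; apply/cvgrPdist_lt => e e0.
have eb0 : 0 < e `^ b^-1 by rewrite powR_gt0.
have /cvgrPdist_lt/(_ _ eb0) := ulim; apply: filterS => k.
rewrite !sub0r !normrN (ger0_norm (u0 k)) (ger0_norm (powR_ge0 _ _)) => uk.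
have -> : e = e `^ b^-1 `^ b by rewrite -powRrM mulVf ?gt_eqF// powRr1// ltW.
by rewrite gt0_ltr_powR ?nnegrE ?powR_ge0.
Qed.

Lemma summable_tail u : (forall k, 0 <= u k) ->
  (\sum_(1 <= k <oo) (u k)%:E < +oo)%E ->
  exists tail : nat -> R, [/\ forall k, 0 <= tail k,
    forall k, (0 < k)%N -> tail k.+1 = tail k - u k & tail @ \oo --> 0].
Proof.
move=> u0 usum; pose S k := \sum_(1 <= i < k) u i.
have S_nd : nondecreasing_seq S.
  apply/nondecreasing_seqP => -[|k]; first by rewrite /S !big_geq.
  by rewrite /S [leRHS]big_nat_recr//= lerDl.
have sum_fin : (\sum_(1 <= k <oo) (u k)%:E)%E \is a fin_num.
  rewrite ge0_fin_numE//; apply: nneseries_ge0 => i _ _; by rewrite lee_fin.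
have S_ub k : S k <= fine (\sum_(1 <= k <oo) (u k)%:E)%E.
  rewrite -lee_fin fineK// /S -sumEFin; apply: nneseries_lim_ge => i _ _.
  by rewrite lee_fin.
have S_cvg : cvgn S.
  by apply: nondecreasing_is_cvgn => //; eexists => _ [k _ <-]; exact: S_ub.
exists (fun k => limn S - S k); split => [k|k k0|].
- by rewrite subr_ge0; exact: nondecreasing_cvgn_le.
- by rewrite /S big_nat_recr//= opprD addrA.
- by rewrite -(subrr (limn S)); apply: cvgB => //; exact: cvg_cst.
Qed.

Lemma harmonic_unbounded W (K : nat) : (forall k, 0 <= W k) ->
  (forall k, (K <= k)%N -> k.+1%:R^-1 <= W k - W k.+1) -> False.
Proof.
move=> W0 h; apply: (@dvg_harmonic R).
have nd : nondecreasing_seq (series (@harmonic R)).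
  apply/nondecreasing_seqP => j; rewrite /series/= big_nat_recr//= lerDl.
  by rewrite /harmonic invr_ge0.
apply: nondecreasing_is_cvgn => //.
have bound j : series harmonic (K + j)%N <= series harmonic K + (W K - W (K + j)%N).
  elim: j => [|j IH]; first by rewrite addn0 subrr addr0.
  have -> : series harmonic (K + j.+1)%N = series harmonic (K + j)%N + (K + j).+1%:R^-1 :> R.
    by rewrite addnS /series/= big_nat_recr.
  apply: (le_trans (lerD IH (h _ (leq_addr _ _)))).
  by rewrite addnS -addrA subrKA.
exists (series harmonic K + W K) => _ [k _ <-].
apply: (le_trans (nd _ _ (leq_addl K k))); apply: (le_trans (bound k)).
by rewrite lerD2l gerBl.
Qed.

(** As long as the distance is below r, the distance plus the remaining length W
    cannot grow; starting from a small enough sum it stays small forever. *)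
Lemma trapped D W (r : R) (K0 : nat) : 0 < r ->
  (forall k, 0 <= W k) -> W @ \oo --> 0 ->
  (forall k, (K0 <= k)%N -> D k < r -> D k.+1 + W k.+1 <= D k + W k) ->
  (forall e K, 0 < e -> exists2 k, (K <= k)%N & D k < e) ->
  forall e, 0 < e -> exists K, forall k, (K <= k)%N -> D k < e.
Proof.
move=> r0 W0 Wlim step often e e0.
pose e' := Num.min e r; have e'0 : 0 < e' by rewrite lt_min e0.
have /cvgrPdist_lt/(_ _ (divr_gt0 e'0 (ltr0n _ 2)))[K1 _ WK1] := Wlim.
have [K KK DK] := often (e' / 2) (maxn K0 K1) (divr_gt0 e'0 (ltr0n _ 2)).
exists K => k Kk; rewrite -(subnKC Kk); move: (k - K)%N => j {k Kk}.
have [K0K K1K] : (K0 <= K)%N /\ (K1 <= K)%N by move: KK; rewrite geq_max => /andP.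
have VK : D K + W K < e'.
  have := WK1 K K1K; rewrite /= sub0r normrN ger0_norm// => WK.
  by rewrite [ltRHS]splitr ltrD.
suff : D (K + j)%N + W (K + j)%N < e'.
  move=> VKj; have : D (K + j)%N < e' by rewrite (le_lt_trans _ VKj)// lerDl.
  by rewrite lt_min => /andP[].
elim: j => [|j IH]; first by rewrite addn0.
rewrite addnS (le_lt_trans _ IH)// step ?(leq_trans K0K) ?leq_addr//.
by rewrite (le_lt_trans _ (lt_le_trans IH _)) ?lerDl// ge_min lexx orbT.
Qed.

End Sequences.

(** * Local properties at an accumulation point *)

Section LocalProperties.
Context {R : realType} {n : nat}.
Implicit Types (f : 'cV[R]_n -> R) (x y v : 'cV[R]_n).

(** The Hessian bounds hold up to distance 2 r, so that they apply along segments
    of length at most r that start within distance r. *)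
Lemma local_bounds f (xs : 'cV[R]_n) (V : set 'cV[R]_n) : twice_continuously_differentiable f ->
  nbhs xs V -> locally_lipschitz_on V (hess f) ->
  exists r M L G : R, [/\ [/\ 0 < r, 1 <= M, 0 < L & 1 <= G],
    forall y, norm2 (y - xs) < r -> norm2 (grad f y) <= G,
    forall y v, norm2 (y - xs) < r + r -> norm2 (hess f y *m v) <= M * norm2 v &
    forall y x v, norm2 (y - xs) < r + r -> norm2 (x - xs) < r + r ->
      norm2 ((hess f y - hess f x) *m v) <= L * norm2 (y - x) * norm2 v].
Proof.
move=> [_ dg ch] Vxs lipH; have [L0 [U [Uxs UL]]] := lipH _ (nbhs_singleton Vxs).
have [r1 r10 UV] := nbhs_norm2_ball (filterI Uxs Vxs).
have [r2 r20 Hr2] : exists2 r, 0 < r & forall y, norm2 (y - xs) < r ->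
    `|hess f y| <= `|hess f xs| + 1.
  apply: (@nbhs_norm2_ball _ _ _ [set y | `|hess f y| <= `|hess f xs| + 1]).
  have /cvgrPdist_le/(_ _ ltr01) := ch xs; apply: filterS => y /=.
  rewrite distrC => h; rewrite -lerBlDl; apply: le_trans h; exact: lerB_dist.
have [r3 r30 Hr3] : exists2 r, 0 < r & forall y, norm2 (y - xs) < r ->
    `|grad f y| <= `|grad f xs| + 1.
  apply: (@nbhs_norm2_ball _ _ _ [set y | `|grad f y| <= `|grad f xs| + 1]).
  have /cvgrPdist_le/(_ _ ltr01) := differentiable_continuous (dg xs).
  apply: filterS => y /=.
  rewrite distrC => h; rewrite -lerBlDl; apply: le_trans h; exact: lerB_dist.
pose r := Num.min r1 (Num.min r2 r3) / 2.
have r0 : 0 < r by rewrite divr_gt0// !lt_min r10 r20 r30.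
have rr : r + r = Num.min r1 (Num.min r2 r3) by rewrite /r -splitr.
have [rr1 rr2 rr3] : [/\ r + r <= r1, r + r <= r2 & r + r <= r3].
  by rewrite rr !ge_min !lexx !orbT.
exists r, (n%:R * n%:R * (`|hess f xs| + 1) + 1), (`|L0| + 1),
  (n%:R * (`|grad f xs| + 1) + 1).
split.
- split => //; rewrite ?lerDr ?ltr_wpDl// ?mulr_ge0// addr_ge0//.
- move=> y yr; apply: (le_trans (norm2_le_mx_norm _)).
  rewrite ler_wpDr// ler_wpM2l// Hr3// (lt_le_trans yr)//.
  by apply: le_trans rr3; rewrite lerDl ltW.
- move=> y v yr; apply: (le_trans (norm2_mulmx _ _)).
  rewrite ler_wpM2r ?norm2_ge0// ler_wpDr// ler_wpM2l ?mulr_ge0// Hr2//.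
  exact: lt_le_trans yr rr2.
- move=> y x v yr xr; apply: (le_trans (norm2_spectral_norm _ _)).
  rewrite ler_wpM2r ?norm2_ge0//.
  apply: (le_trans (UL _ _ (UV _ (lt_le_trans yr rr1)) (UV _ (lt_le_trans xr rr1)))).
  by rewrite ler_wpM2r ?norm2_ge0// (le_trans (ler_norm _))// lerDl.
Qed.

Lemma accumulation_often (x : nat -> 'cV[R]_n) (xs : 'cV[R]_n) (e : R) K :
  accumulation_points x xs -> 0 < e -> exists2 k, (K <= k)%N & norm2 (x k - xs) < e.
Proof.
rewrite /accumulation_points/= limn_einf_lim => lim0 e0.
apply: contrapT => /forall2NP far.
have : (e%:E <= limn (einfs (fun k => (norm2 (x k - xs))%:E)))%E.
  apply: lime_ge; first exact: is_cvg_einfs.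
  exists K => // m /= Km; apply: le_ereal_inf_tmp => _ [k mk <-].
  rewrite lee_fin leNgt; apply/negP.
  by have [/(_ (leq_trans Km mk))|] := far k.
by rewrite lim0 lee_fin leNgt e0.
Qed.

Lemma lojasiewicz_bound f (xs : 'cV[R]_n) (theta : R) : 0 <= theta < 1 -> lojasiewicz f xs theta ->
  exists r kappa eta : R, [/\ [/\ 0 < r, 0 < kappa, 0 < eta & eta <= 1] &
    forall y, norm2 (y - xs) < r -> 0 < f y - f xs < eta ->
      kappa * (f y - f xs) `^ theta <= norm2 (grad f y)].
Proof.
move=> /andP[th0 th1] [c [eta [V [c0 eta0 /nbhs_norm2_ball[r r0 rV] loj]]]].
have th1' : 0 < 1 - theta by rewrite subr_gt0.
have [eta1 [eta10 eta11 eta1eta]] : exists eta1 : R,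
    [/\ 0 < eta1, eta1 <= 1 & (eta1%:E <= eta)%E].
  case: eta eta0 {loj} => [eta eta0|_|//].
    exists (Num.min 1 eta); split; rewrite ?ge_min ?lexx// ?lee_fin ?ge_min ?lexx ?orbT//.
    by rewrite lt_min ltr01 -lte_fin.
  by exists 1; rewrite leey.
exists r, (c * (1 - theta))^-1, eta1; split.
  by split => //; rewrite invr_gt0 mulr_gt0.
move=> y yr /andP[t0 teta]; set t := f y - f xs in t0 teta *.
have := loj y (rV _ yr) t0 (lt_le_trans _ eta1eta).
rewrite lte_fin => /(_ teta).
have -> : derive1 (fun t => c * t `^ (1 - theta)) t = c * (1 - theta) * t `^ (- theta).
  rewrite derive1E; apply: derive_val.
  have -> : c * (1 - theta) * t `^ (- theta) = c *: ((1 - theta) * t `^ ((1 - theta) - 1)).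
    by rewrite addrAC subrr sub0r [RHS]mulrA.
  by apply: is_deriveZ; exact: is_derive1_powR.
rewrite powRN mulrAC ler_pdivlMr ?powR_gt0// mul1r => h.
by rewrite ler_pdivrMl// mulr_gt0.
Qed.

End LocalProperties.

(** * The generated sequence *)

Section Run.
Context {R : realType} {n : nat} (f : 'cV[R]_n -> R) (P : minres_params R).
Context (x : nat -> 'cV[R]_n) (B : nat -> 'M[R]_n) (d : nat -> 'cV[R]_n).
Context (fl : nat -> flag) (lam : nat -> R).
Hypothesis f_C2 : twice_continuously_differentiable f.
Hypothesis x_run : minres_linesearch P f x B d fl lam.
Hypothesis B_hess : forall k, B k = hess f (x k).
Hypothesis no_stop : forall k, grad f (x k) != 0.

Local Notation rho := (ls_rho P).
Local Notation sigma := (ls_sigma P).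
Local Notation g k := (grad f (x k)).
Local Notation w k := (curvature_threshold P k (grad f (x k))).
Local Notation u k := (ls_a P k `^ (- (ls_alpha P)^-1)).
Local Notation step k := (norm2 (x k.+1 - x k)).

Let df y : differentiable f y. Proof. by case: f_C2 => + _ _; apply. Qed.
Let dg y : differentiable (grad f) y. Proof. by case: f_C2 => _ + _; apply. Qed.
Let rho0 : 0 < rho. Proof. by case/andP: (ls_rho_range P). Qed.
Let sigma0 : 0 < sigma. Proof. by case/andP: (ls_sigma_range P). Qed.
Let sigma1 : sigma < 1. Proof. by case/andP: (ls_sigma_range P). Qed.
Let s0 : 0 < ls_s P. Proof. exact: ls_s_gt0. Qed.

Lemma hess_sym k : hess f (x k) \is symmetricmx.
Proof. by have [+ _] := x_run (fun i (_ : (i < k)%N) => no_stop i); rewrite B_hess. Qed.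

Lemma run_step k : [/\ direction_step P k (g k) (Bbar P B k) (d k) (fl k),
  stepsize P f (x k) (d k) (hess f (x k)) (fl k) (lam k) & x k.+1 = x k + lam k *: d k].
Proof.
have [_] := x_run (fun i (_ : (i < k)%N) => no_stop i).
by rewrite B_hess; apply; exact: no_stop.
Qed.

Lemma Bbar_sym k : Bbar P B k \is symmetricmx.
Proof.
apply/is_hermitianmxP; rewrite expr0 scale1r map_mx_id// /Bbar B_hess.
by rewrite linearD/= tr_scalar_mx (symmetricmx_tr (hess_sym k)).
Qed.

Lemma run_diff k : x k.+1 - x k = lam k *: d k.
Proof. by have [_ _ ->] := run_step k; rewrite addrC addKr. Qed.

Lemma Bbar_hess k : Bbar P B k = hess f (x k) + (ls_zeta P k)%:M.
Proof. by rewrite /Bbar B_hess. Qed.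

Lemma value_nonincreasing k : f (x k.+1) <= f (x k).
Proof.
have [dir stp ->] := run_step k; have [flN|flN] := pselect (fl k = NPC).
  rewrite flN in dir stp; have [curv desc] := direction_NPC dir.
  have [l0 + _] := stepsize_NPC stp; rewrite /armijo_npc => h.
  rewrite -subr_le0 (le_trans h)//.
  move: curv; rewrite Bbar_hess mulmxDl mul_scalar_mx dotDr dotZr => curv.
  have H0 : dot (d k) (hess f (x k) *m d k) <= 0.
    by rewrite (le_trans _ curv)// lerDl mulr_ge0 ?dot_ge0// ls_zeta_ge0.
  rewrite -[leRHS]addr0 lerD// mulr_ge0_le0//; first by rewrite mulr_ge0// ltW.
  by rewrite mulr_ge0 ?sqr_ge0// divr_ge0// ltW.
have [desc _] := direction_descent (Bbar_sym k) (no_stop k) flN dir.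
apply: armijo_le flN _ stp; rewrite -oppr_ge0 (le_trans _ desc)//.
by rewrite mulr_ge0 ?sqr_ge0// curvature_threshold_ge0.
Qed.

Lemma value_limit xs : accumulation_points x xs ->
  (forall k, f xs <= f (x k)) /\ (fun k => f (x k) - f xs) @ \oo --> 0.
Proof.
move=> acc.
have often (e : R) K : 0 < e -> exists2 k, (K <= k)%N & `|f (x k) - f xs| < e.
  move=> e0; have cf := differentiable_continuous (df xs).
  have /cvgrPdist_lt/(_ _ e0)/nbhs_norm2_ball[r r0 hr] := cf.
  have [k Kk kr] := accumulation_often K acc r0.
  by exists k => //; rewrite distrC; exact: hr.
have mono : {homo (fun k => f (x k)) : i j / (i <= j)%N >-> j <= i}.
  move=> i j ij; rewrite -(subnKC ij); elim: (j - i)%N => [|m IH]; first by rewrite addn0.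
  by rewrite addnS (le_trans (value_nonincreasing _)).
have lb k : f xs <= f (x k).
  rewrite leNgt; apply/negP => lt_f.
  have [j kj] := often (f xs - f (x k)) k (eqbRL (subr_gt0 _ _) lt_f).
  rewrite distrC ltr_norml => /andP[_].
  by rewrite ltrD2l ltrN2 ltNge mono.
split => //; apply/cvgrPdist_lt => e e0; have [K _ Ke] := often e 0%N e0.
exists K => // k /= Kk; rewrite sub0r normrN ger0_norm ?subr_ge0//.
rewrite (le_lt_trans _ Ke)// ger0_norm ?subr_ge0// lerD2r; exact: mono.
Qed.

Section Near.
Context (xs : 'cV[R]_n) (r M L G : R).
Hypothesis r0 : 0 < r.
Hypothesis M1 : 1 <= M.
Hypothesis L0 : 0 < L.
Hypothesis G1 : 1 <= G.
Hypothesis grad_bounded : forall y, norm2 (y - xs) < r -> norm2 (grad f y) <= G.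
Hypothesis hess_bounded : forall y v, norm2 (y - xs) < r + r ->
  norm2 (hess f y *m v) <= M * norm2 v.
Hypothesis hess_lip : forall y z v, norm2 (y - xs) < r + r -> norm2 (z - xs) < r + r ->
  norm2 ((hess f y - hess f z) *m v) <= L * norm2 (y - z) * norm2 v.
Context (capZ zexp zbar : R) (z : nat -> R).
Hypothesis capZ_gt0 : 0 < capZ.
Hypothesis zexp_range : 0 < zexp <= 3^-1.
Hypothesis zbar_gt0 : 0 < zbar.
Hypothesis z_lower : forall k, zbar <= z k.
Hypothesis zeta_def : forall k,
  ls_zeta P k = Num.min capZ (z k * norm2 (g k) `^ zexp).

Lemma near_ball k y : norm2 (x k - xs) < r -> norm2 (y - x k) < r ->
  norm2 (y - xs) < r + r.
Proof.
move=> kr yr; rewrite -(subrKA (x k)) (le_lt_trans (ler_norm2D _ _))//.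
by rewrite ltrD.
Qed.

Lemma xs_near k : norm2 (x k - xs) < r -> norm2 (x k - xs) < r + r.
Proof. by move=> /lt_le_trans; apply; rewrite lerDl ltW. Qed.

Lemma zeta_le k : ls_zeta P k <= capZ.
Proof. by rewrite zeta_def ge_min lexx. Qed.

(** The exponent bound 1/3 is what makes the cube of the regularization dominate
    the gradient. *)
Lemma gradient_le_zeta3 : exists2 c : R, 0 < c &
  forall k, norm2 (x k - xs) < r -> c * norm2 (g k) <= ls_zeta P k ^+ 3.
Proof.
pose c := Num.min capZ zbar; have c0 : 0 < c by rewrite lt_min capZ_gt0.
have G0 : 0 < G by exact: lt_le_trans G1.
exists (c ^+ 3 / G) => [|k /grad_bounded gG]; first by rewrite divr_gt0// exprn_gt0.
have gk0 : 0 < norm2 (g k) by rewrite norm2_gt0.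
pose t := norm2 (g k) / G.
have t0 : 0 < t by rewrite divr_gt0.
have t1 : t <= 1 by rewrite ler_pdivrMr// mul1r.
have tg : t <= norm2 (g k) by rewrite ler_pdivrMr// ler_peMr// ltW.
have [ze0 ze3] := andP zexp_range.
have ct : c * t `^ 3^-1 <= ls_zeta P k.
  rewrite zeta_def le_min; apply/andP; split.
    apply: (@le_trans _ _ c); last by rewrite ge_min lexx.
    by rewrite ler_piMr ?(ltW c0)// -[leRHS](powRr0 t) ger_powR ?t0// invr_ge0.
  rewrite ler_pM ?powR_ge0 ?(ltW c0)//.
    by rewrite (le_trans _ (z_lower k))// ge_min lexx orbT.
  apply: (@le_trans _ _ (t `^ zexp)); first by rewrite ger_powR ?t0.
  by rewrite ge0_ler_powR ?nnegrE ?norm2_ge0// ltW.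
have -> : c ^+ 3 / G * norm2 (g k) = (c * t `^ 3^-1) ^+ 3.
  rewrite exprMn -(powR_mulrn 3 (powR_ge0 _ _)) -powRrM mulVf ?pnatr_eq0//.
  by rewrite powRr1 ?(ltW t0)// /t; ring.
by apply: lerXn2r => //; rewrite nnegrE ?ls_zeta_ge0// mulr_ge0 ?powR_ge0// ltW.
Qed.

Lemma NPC_decrease : exists2 c : R, 0 < c & forall k, norm2 (x k - xs) < r ->
  fl k = NPC -> c * ls_zeta P k <= step k /\
    sigma / 2 * ls_zeta P k * step k ^+ 2 <= f (x k) - f (x k.+1).
Proof.
exists (rho * Num.min (r / capZ) ((1 - sigma) / L)) => [|k kr flN].
  by rewrite mulr_gt0// lt_min !divr_gt0// subr_gt0.
have [dir stp xk1] := run_step k; rewrite flN in dir stp.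
have [curv desc] := direction_NPC dir; rewrite Bbar_hess in curv.
rewrite run_diff xk1.
have lip y v : norm2 (y - x k) < r ->
    norm2 ((hess f y - hess f (x k)) *m v) <= L * norm2 (y - x k) * norm2 v.
  by move=> yr; apply: hess_lip; [exact: near_ball kr yr|exact: xs_near].
exact: (step_NPC df dg L0 lip (ls_zeta_ge0 P k) (zeta_le k) capZ_gt0 r0 curv desc stp).
Qed.

Lemma Bbar_bound k v : norm2 (x k - xs) < r ->
  norm2 (Bbar P B k *m v) <= (M + capZ) * norm2 v.
Proof.
move=> kr; rewrite Bbar_hess mulmxDl mul_scalar_mx (le_trans (ler_norm2D _ _))//.
rewrite mulrDl lerD ?hess_bounded ?xs_near// norm2Z ger0_norm ?ls_zeta_ge0//.
by rewrite ler_wpM2r ?norm2_ge0// zeta_le.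
Qed.

Let C := M + capZ.
Let C1 : 1 <= C. Proof. by rewrite ler_wpDr// ltW. Qed.
Let C0 : 0 < C. Proof. exact: lt_le_trans C1. Qed.

Lemma descent_facts k : norm2 (x k - xs) < r -> fl k <> NPC ->
  [/\ 0 < lam k <= ls_s P, w k * norm2 (d k) ^+ 2 <= - dot (g k) (d k),
      w k * norm2 (g k) <= C ^+ 2 * norm2 (d k) &
      sigma * lam k * (w k * norm2 (d k) ^+ 2) <= f (x k) - f (x k.+1)].
Proof.
move=> kr flN; have [dir stp xk1] := run_step k.
have [desc low] := direction_descent (Bbar_sym k) (no_stop k) flN dir.
have [lk arm _] := stepsize_armijo flN stp; have /andP[l0 _] := lk.
split => //; first by apply: low => // v; exact: Bbar_bound.
move: arm; rewrite /armijo xk1 dotC => arm.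
have : sigma * lam k * (w k * norm2 (d k) ^+ 2) <= sigma * lam k * - dot (g k) (d k).
  by rewrite ler_wpM2l// mulr_ge0// ltW.
by move: arm; lra.
Qed.

(** If the threshold is ls_capA, the descent direction makes an angle bounded
    away from a right angle with the gradient. Otherwise |d| <= |g|^(1 - alpha) / a
    with |g| < a^(-1/alpha), which gives |d| <= a^(-1/alpha). *)
Lemma iteration_length : exists2 c : R, 0 < c & forall k, norm2 (x k - xs) < r ->
  step k <= ls_s P * u k \/ c * norm2 (g k) * step k <= f (x k) - f (x k.+1).
Proof.
have [c1 c10 NPCd] := NPC_decrease; have [c2 c20 gz] := gradient_le_zeta3.
pose A := ls_capA P; have /andP[A0 A1] := ls_capA_range P.
have /andP[al0 al1] := ls_alpha_range P.
pose cN := sigma / 2 * c1 * c2 / capZ; pose cD := sigma * A ^+ 2 / C ^+ 2.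
have cN0 : 0 < cN by rewrite divr_gt0// mulr_gt0// mulr_gt0// divr_gt0.
have cD0 : 0 < cD by rewrite divr_gt0 ?exprn_gt0// mulr_gt0// exprn_gt0.
exists (Num.min cN cD) => [|k kr]; first by rewrite lt_min cN0.
have gk0 : 0 < norm2 (g k) by rewrite norm2_gt0.
have weaken c : Num.min cN cD <= c ->
    c * norm2 (g k) * step k <= f (x k) - f (x k.+1) ->
    Num.min cN cD * norm2 (g k) * step k <= f (x k) - f (x k.+1).
  by move=> mc; apply: le_trans; rewrite ler_wpM2r ?norm2_ge0// ler_wpM2r// ltW.
have [flN|flN] := pselect (fl k = NPC).
  right; apply: (weaken cN); first by rewrite ge_min lexx.
  have [lo dec] := NPCd k kr flN; apply: le_trans dec.
  have ze0 := ls_zeta_ge0 P k; have zeZ := zeta_le k; have g3 := gz k kr.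
  set D := step k in lo *; set ze := ls_zeta P k in lo ze0 zeZ g3 *.
  have D0 : 0 <= D := norm2_ge0 _.
  have sz : 0 <= sigma / 2 * ze by rewrite mulr_ge0// divr_ge0// ltW.
  have h : c2 * norm2 (g k) / capZ <= ze ^+ 2.
    by rewrite ler_pdivrMr// (le_trans g3)// exprSr ler_wpM2l ?sqr_ge0.
  have h2 : sigma / 2 * ze * (c1 * ze * D) <= sigma / 2 * ze * D ^+ 2.
    rewrite (ler_wpM2l sz)//.
    by rewrite expr2 ler_wpM2r.
  apply: le_trans h2.
  have h3 : (sigma / 2 * c1 * D) * (c2 * norm2 (g k) / capZ) <= (sigma / 2 * c1 * D) * ze ^+ 2.
    by rewrite ler_wpM2l// mulr_ge0// mulr_ge0 ?divr_ge0// ltW.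
  have -> : cN * norm2 (g k) * D = (sigma / 2 * c1 * D) * (c2 * norm2 (g k) / capZ).
    by rewrite /cN; ring.
  by apply: le_trans h3 _; rewrite le_eqVlt; apply/orP; left; apply/eqP; ring.
have [/andP[l0 ls] wd wg dec] := descent_facts kr flN.
have DE : step k = lam k * norm2 (d k) by rewrite run_diff norm2Z gtr0_norm.
have [big|small] := leP A (ls_a P k * norm2 (g k) `^ ls_alpha P).
  right; apply: (weaken cD); first by rewrite ge_min lexx orbT.
  have wA : w k = A by rewrite /curvature_threshold min_l.
  rewrite wA in wd wg dec; apply: le_trans dec.
  have : (sigma * lam k * A * norm2 (d k)) * (A * norm2 (g k)) <=
     (sigma * lam k * A * norm2 (d k)) * (C ^+ 2 * norm2 (d k)).
    by rewrite ler_wpM2l// mulr_ge0 ?norm2_ge0// mulr_ge0 ?(ltW A0)// mulr_ge0// ltW.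
  rewrite DE => h.
  have C20 : 0 < C ^+ 2 by rewrite exprn_gt0.
  rewrite -(ler_pM2r C20).
  have -> : cD * norm2 (g k) * (lam k * norm2 (d k)) * C ^+ 2 =
     sigma * lam k * A * norm2 (d k) * (A * norm2 (g k)).
    by rewrite /cD; field; rewrite gt_eqF.
  by apply: le_trans h _; rewrite le_eqVlt; apply/orP; left; apply/eqP; ring.
left; rewrite DE ler_pM ?norm2_ge0 ?(ltW l0)//.
have wE : w k = ls_a P k * norm2 (g k) `^ ls_alpha P.
  by rewrite /curvature_threshold min_r// ltW.
rewrite (threshold_powR (ls_a_gt0 P k)) ?norm2_ge0// in small wE.
have u0 : 0 < u k by rewrite powR_gt0// ls_a_gt0.
set t := norm2 (g k) / u k in small wE.
have t0 : 0 < t by rewrite divr_gt0.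
have t1 : t < 1.
  rewrite ltNge; apply/negP => t1.
  have : 1 <= t `^ ls_alpha P by rewrite -[leLHS](powRr0 t) ler_powR// ltW.
  by rewrite leNgt (lt_le_trans small).
have wt : t <= w k by rewrite wE ger1_powR// t0 ltW.
have w0 : 0 < w k by exact: lt_le_trans wt.
have [->|dn0] := eqVneq (norm2 (d k)) 0; first exact: ltW.
have dp : 0 < norm2 (d k) by rewrite lt_def dn0 norm2_ge0.
have : w k * norm2 (d k) <= norm2 (g k).
  rewrite -(ler_pM2r dp) -mulrA -expr2 (le_trans wd)//.
  by rewrite -dotNl -[norm2 (g k)]norm2N CauchySchwarz_dot.
have -> : norm2 (g k) = t * u k by rewrite divfK// gt_eqF.
by move=> h; rewrite -(ler_pM2l w0) (le_trans h)// ler_wpM2r// ltW.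
Qed.

(** A descent step shorter than rho r is the initial trial or follows a trial
    rejected inside the ball, so that lam is at least a multiple of w. *)
Lemma iteration_decrease : exists2 c : R, 0 < c & forall k, norm2 (x k - xs) < r ->
  step k < rho * r ->
  (fl k = NPC -> c * ls_zeta P k ^+ 3 <= f (x k) - f (x k.+1)) /\
  (fl k <> NPC -> c * w k ^+ 4 * norm2 (g k) ^+ 2 <= f (x k) - f (x k.+1)).
Proof.
have [c1 c10 NPCd] := NPC_decrease.
pose c2 := Num.min (ls_s P) (rho * (1 - sigma) / M).
have M0 : 0 < M by exact: lt_le_trans M1.
have c20 : 0 < c2 by rewrite lt_min s0 divr_gt0// mulr_gt0// subr_gt0.
pose cN := sigma / 2 * c1 ^+ 2; pose cD := sigma * c2 / C ^+ 4.
have cN0 : 0 < cN by rewrite mulr_gt0 ?exprn_gt0// divr_gt0.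
have cD0 : 0 < cD by rewrite divr_gt0 ?exprn_gt0// mulr_gt0.
exists (Num.min cN cD) => [|k kr short]; first by rewrite lt_min cN0.
split => flN.
  have [lo dec] := NPCd k kr flN; apply: le_trans dec.
  have ze0 := ls_zeta_ge0 P k.
  set D := step k in lo *; set ze := ls_zeta P k in lo ze0 *.
  have D0 : 0 <= D := norm2_ge0 _.
  apply: (@le_trans _ _ (cN * ze ^+ 3)).
    by rewrite ler_wpM2r ?exprn_ge0// ge_min lexx.
  have -> : cN * ze ^+ 3 = sigma / 2 * ze * (c1 * ze) ^+ 2 by rewrite /cN; ring.
  have sz : 0 <= sigma / 2 * ze by rewrite mulr_ge0// divr_ge0// ltW.
  rewrite (ler_wpM2l sz)//.
  by rewrite ler_sqr// nnegrE// mulr_ge0// ltW.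
have [/andP[l0 ls] wd wg dec] := descent_facts kr flN.
have [_ stp _] := run_step k.
have w0 : 0 <= w k by exact: curvature_threshold_ge0.
have := step_lower_descent df dg M1
  (fun y v yr => hess_bounded v (near_ball kr yr)) flN wd stp.
rewrite -/c2 => -[lk|]; last first.
  by rewrite leNgt; move: short; rewrite run_diff norm2Z gtr0_norm// => ->.
apply: le_trans dec.
apply: (@le_trans _ _ (cD * w k ^+ 4 * norm2 (g k) ^+ 2)).
  by rewrite ler_wpM2r ?sqr_ge0// ler_wpM2r ?exprn_ge0// ge_min lexx orbT.
have C40 : 0 < C ^+ 4 by rewrite exprn_gt0.
have wg2 : (w k * norm2 (g k)) ^+ 2 <= (C ^+ 2 * norm2 (d k)) ^+ 2.
  by rewrite ler_sqr// nnegrE mulr_ge0 ?norm2_ge0// ?sqr_ge0.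
apply: (@le_trans _ _ (sigma * (c2 * w k) * (w k * norm2 (d k) ^+ 2))); last first.
  apply: ler_wpM2r; first by rewrite mulr_ge0 ?sqr_ge0.
  by rewrite ler_wpM2l// ltW.
rewrite -(ler_pM2r C40).
have -> : cD * w k ^+ 4 * norm2 (g k) ^+ 2 * C ^+ 4 =
   (sigma * c2 * w k ^+ 2) * (w k * norm2 (g k)) ^+ 2.
  by rewrite /cD; field; rewrite gt_eqF.
have -> : sigma * (c2 * w k) * (w k * norm2 (d k) ^+ 2) * C ^+ 4 =
   (sigma * c2 * w k ^+ 2) * (C ^+ 2 * norm2 (d k)) ^+ 2 by ring.
by rewrite ler_wpM2l// mulr_ge0 ?sqr_ge0// mulr_ge0// ltW.
Qed.

Context (kappa eta theta : R).
Hypothesis xs_acc : accumulation_points x xs.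
Hypothesis kappa0 : 0 < kappa.
Hypothesis eta0 : 0 < eta.
Hypothesis eta1 : eta <= 1.
Hypothesis theta_range : 0 <= theta < 1.
Hypothesis loj : forall y, norm2 (y - xs) < r -> 0 < f y - f xs < eta ->
  kappa * (f y - f xs) `^ theta <= norm2 (grad f y).
Hypothesis a_summable :
  (\sum_(1 <= k <oo) (ls_a P k `^ (- (ls_alpha P)^-1))%:E < +oo)%E.

Local Notation e k := (f (x k) - f xs).
Let b := (1 - theta) / 2.
Let b0 : 0 < b.
Proof. by have /andP[_ th1] := theta_range; rewrite divr_gt0// subr_gt0. Qed.
Let b1 : b < 1.
Proof. by have /andP[th0 _] := theta_range; rewrite /b; lra. Qed.

Lemma gap_ge0 k : 0 <= e k.
Proof. by have [lb _] := value_limit xs_acc; rewrite subr_ge0. Qed.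

Lemma gap_le k : e k.+1 <= e k.
Proof. by rewrite lerD2r value_nonincreasing. Qed.

Lemma gap_diff k : f (x k) - f (x k.+1) = e k - e k.+1.
Proof. by ring. Qed.

Lemma gap_lt (t : R) : 0 < t -> \forall k \near \oo, e k < t.
Proof.
have [_ /cvgrPdist_lt lim] := value_limit xs_acc; move=> /lim; apply: filterS => k.
by rewrite sub0r normrN ger0_norm ?gap_ge0.
Qed.

(** The remaining length is controlled by a power of the gap in f together with
    the tail of the summable bounds for the iterations in which the angle with the
    gradient is not controlled. *)
Lemma iterates_converge (t : R) : 0 < t ->
  exists K, forall k, (K <= k)%N -> norm2 (x k - xs) < t.
Proof.
have [c c0 len] := iteration_length.
have [tail [tail0 tailS tail_lim]] := summable_tail (fun k => powR_ge0 _ _) a_summable.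
have [K1 _ eK1] := gap_lt eta0.
pose W k := (b * c * kappa)^-1 * e k `^ b + ls_s P * tail k.
have C0' : 0 < (b * c * kappa)^-1 by rewrite invr_gt0; exact: mulr_gt0 (mulr_gt0 b0 c0) kappa0.
apply: (@trapped _ (fun k => norm2 (x k - xs)) W r (maxn K1 1)) => //.
- by move=> k; rewrite addr_ge0// mulr_ge0 ?powR_ge0 ?tail0// ltW.
- have -> : 0 = (b * c * kappa)^-1 * 0 + ls_s P * 0 by rewrite !mulr0 addr0.
  apply: cvgD; apply: cvgMr; last exact: tail_lim.
  have [_ elim] := value_limit xs_acc.
  exact: powR_cvg_to0 gap_ge0 b0 elim.
- move=> k; rewrite geq_max => /andP[K1k k0] kr.
  have tri : norm2 (x k.+1 - xs) <= norm2 (x k - xs) + step k.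
    by rewrite -(subrKA (x k)) addrC ler_norm2D.
  suff : step k <= W k - W k.+1 by lra.
  have eb : e k.+1 `^ b <= e k `^ b.
    by rewrite ge0_ler_powR ?nnegrE ?gap_ge0 ?(ltW b0)// gap_le.
  have ek1 : e k < eta := eK1 k K1k.
  rewrite /W tailS//; have [small|dec] := len k kr.
    have : 0 <= (b * c * kappa)^-1 * (e k `^ b - e k.+1 `^ b).
      by rewrite mulr_ge0 ?(ltW C0')// subr_ge0.
    by move: small; lra.
  have : step k <= (b * c * kappa)^-1 * (e k `^ b - e k.+1 `^ b).
    apply: (@lojasiewicz_length _ theta kappa c (e k) (e k.+1) (norm2 (g k))) => //.
    - by rewrite norm2_gt0.
    - exact: norm2_ge0.
    - by rewrite gap_ge0 gap_le.
    - by rewrite (le_trans (ltW ek1)).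
    - by move=> ek0; apply: loj; rewrite ?ek0.
    - by rewrite -gap_diff.
  have : 0 <= ls_s P * u k by rewrite mulr_ge0 ?powR_ge0// ltW.
  lra.
- by move=> t' K t'0; exact: accumulation_often.
Qed.

Lemma cvg_iterates : x @ \oo --> xs.
Proof. exact: cvg_norm2 iterates_converge. Qed.

Lemma iterate_near (t : R) : 0 < t -> \forall k \near \oo, norm2 (x k - xs) < t.
Proof. by move=> /iterates_converge[K hK]; exists K. Qed.

Lemma step_near (t : R) : 0 < t -> \forall k \near \oo, step k < t.
Proof.
move=> t0; have [K hK] := iterates_converge (divr_gt0 t0 (ltr0n _ 2)).
exists K => // k /= Kk; rewrite -(subrKA xs) (le_lt_trans (ler_norm2D _ _))//.
by rewrite [ltRHS]splitr ltrD ?hK ?(leqW Kk)// norm2B hK.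
Qed.

Lemma eventually_decrease : exists2 c : R, 0 < c & \forall k \near \oo,
  (fl k = NPC -> c * ls_zeta P k ^+ 3 <= e k - e k.+1) /\
  (fl k <> NPC -> c * w k ^+ 4 * norm2 (g k) ^+ 2 <= e k - e k.+1).
Proof.
have [c c0 dec] := iteration_decrease; exists c => //.
have := iterate_near r0; have := step_near (mulr_gt0 rho0 r0).
by apply: filterS2 => k sk kr; rewrite -gap_diff; exact: dec.
Qed.

Lemma gradient_cvg : (fun k => g k) @ \oo --> grad f xs.
Proof. exact: (cvg_comp _ _ cvg_iterates (differentiable_continuous (dg xs))). Qed.

(** A nonzero gradient at the limit would keep the decrease bounded below. *)
Lemma grad_limit : grad f xs = 0.
Proof.
apply/eqP; apply/negPn/negP => gn0.
pose t := norm2 (grad f xs) / 2.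
have t0 : 0 < t by rewrite divr_gt0// norm2_gt0.
have [c c0 dec] := eventually_decrease; have [c3 c30 gz] := gradient_le_zeta3.
have [abar abar0 abar_le] := ls_a_lower P.
have /andP[A0 _] := ls_capA_range P; have /andP[al0 _] := ls_alpha_range P.
pose w0 := Num.min (ls_capA P) (abar * t `^ ls_alpha P).
have w00 : 0 < w0 by rewrite lt_min A0 mulr_gt0// powR_gt0.
pose low := Num.min (c * (c3 * t)) (c * w0 ^+ 4 * t ^+ 2).
have low0 : 0 < low.
  rewrite lt_min; apply/andP; split; first exact: mulr_gt0 c0 (mulr_gt0 c30 t0).
  exact: mulr_gt0 (mulr_gt0 c0 (exprn_gt0 _ w00)) (exprn_gt0 _ t0).
near \oo => k.
have [decN decD] : (fl k = NPC -> c * ls_zeta P k ^+ 3 <= e k - e k.+1) /\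
  (fl k <> NPC -> c * w k ^+ 4 * norm2 (g k) ^+ 2 <= e k - e k.+1) by near: k.
have tg : t <= norm2 (g k).
  have : norm2 (g k - grad f xs) < t by near: k; exact: near_norm2 gradient_cvg t0.
  rewrite norm2B; have := ler_norm2D (grad f xs - g k) (g k).
  by rewrite subrK /t; lra.
have kr : norm2 (x k - xs) < r by near: k; exact: iterate_near.
have ek : e k < low by near: k; exact: gap_lt.
suff : low <= e k - e k.+1 by have := gap_ge0 k.+1; lra.
have [flN|flN] := pselect (fl k = NPC).
  apply: le_trans (decN flN); apply: (@le_trans _ _ (c * (c3 * t))).
    by rewrite ge_min lexx.
  by rewrite ler_pM2l// (le_trans _ (gz k kr))// ler_pM2l.
apply: le_trans (decD flN); apply: (@le_trans _ _ (c * w0 ^+ 4 * t ^+ 2)).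
  by rewrite ge_min lexx orbT.
have wk : w0 <= w k.
  rewrite le_min ge_min lexx/= ge_min; apply/orP; right.
  rewrite ler_pM ?powR_ge0 ?(ltW abar0)//.
  by rewrite ge0_ler_powR ?nnegrE ?norm2_ge0// ltW.
apply: ler_pM; [exact: ltW (mulr_gt0 c0 (exprn_gt0 _ w00))|exact: sqr_ge0| |].
  rewrite ler_pM2l//; apply: lerXn2r => //; rewrite nnegrE ?curvature_threshold_ge0//.
  exact: ltW.
by rewrite ler_sqr ?nnegrE ?norm2_ge0// ltW.
Unshelve. all: by end_near. Qed.

Lemma gradient_norm_cvg0 : (fun k => norm2 (g k)) @ \oo --> 0.
Proof.
apply/cvgrPdist_lt => t t0; apply: filterS (near_norm2 gradient_cvg t0) => k.
by rewrite grad_limit subr0 sub0r normrN ger0_norm ?norm2_ge0.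
Qed.

(** A negative curvature step lowers f by a multiple of the gradient norm, more
    than the gap that the Lojasiewicz inequality leaves near the limit. *)
Lemma eventually_not_NPC : \forall k \near \oo, fl k <> NPC.
Proof.
have [c c0 dec] := eventually_decrease; have [c3 c30 gz] := gradient_le_zeta3.
have /andP[th0 th1] := theta_range.
have th1' : 0 < 1 - theta by rewrite subr_gt0.
pose low := kappa * (c * c3) `^ theta.
have low0 : 0 < low by rewrite mulr_gt0// powR_gt0// mulr_gt0.
near=> k => flN.
have [decN _] : (fl k = NPC -> c * ls_zeta P k ^+ 3 <= e k - e k.+1) /\
  (fl k <> NPC -> c * w k ^+ 4 * norm2 (g k) ^+ 2 <= e k - e k.+1) by near: k.
have kr : norm2 (x k - xs) < r by near: k; exact: iterate_near.
have ek : e k < eta by near: k; exact: gap_lt.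
have gk0 : 0 < norm2 (g k) by rewrite norm2_gt0.
have small : norm2 (g k) `^ (1 - theta) < low.
  have : `|0 - norm2 (g k) `^ (1 - theta)| < low.
    near: k; have /cvgrPdist_lt := powR_cvg_to0 (fun k => norm2_ge0 (g k)) th1' gradient_norm_cvg0.
    exact.
  by rewrite sub0r normrN ger0_norm ?powR_ge0.
have ge : c * c3 * norm2 (g k) <= e k.
  have := decN flN; have := gap_ge0 k.+1.
  have : c * (c3 * norm2 (g k)) <= c * ls_zeta P k ^+ 3 by rewrite ler_pM2l// gz.
  lra.
have ek0 : 0 < e k by rewrite (lt_le_trans _ ge)// mulr_gt0// mulr_gt0.
have : kappa * e k `^ theta <= norm2 (g k) by apply: loj; rewrite ?ek0.
have : (c * c3 * norm2 (g k)) `^ theta <= e k `^ theta.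
  by rewrite ge0_ler_powR ?nnegrE ?(ltW ek0)// ltW// mulr_gt0// mulr_gt0.
rewrite powRM ?norm2_ge0 ?(ltW (mulr_gt0 c0 c30))//.
rewrite -(ler_pM2l kappa0) => h1 h2; have := le_trans h1 h2.
rewrite leNgt => /negP; apply.
rewrite [ltLHS](_ : _ = norm2 (g k) `^ (1 - theta) * norm2 (g k) `^ theta); last first.
  by rewrite -powRD ?subrK ?(gt_eqF gk0) ?implybT// powRr1// ltW.
by rewrite mulrA ltr_pM2r// ?powR_gt0.
Unshelve. all: by end_near. Qed.

Hypothesis z_bigO : z =O_\oo (fun k => (k%:R * ln k%:R ^+ 2) `^ zexp).

(** Otherwise the gradient norms would be at least of the order k^-(1 + b / 5),
    and the decreases of e^b together with the terms u would dominate the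
    harmonic series. *)
Lemma zeta_often_small (t : R) (K : nat) : 0 < t ->
  exists2 k, (K <= k)%N & ls_zeta P k < t.
Proof.
move=> t0; apply: contrapT => /forall2NP big.
have [c c0 dec] := eventually_decrease.
have [tail [tail0 tailS _]] := summable_tail (fun k => powR_ge0 _ _) a_summable.
have /eqO_exP[C' C'0 zO] := z_bigO.
have /andP[ze0 _] := zexp_range.
have [c1 c101 glow] := gradient_lower ze0 C'0 t0 (divr_gt0 b0 (ltr0n _ 5)).
pose c2 := ls_capA P ^+ 4 * c1 ^+ 5.
have /andP[c10 c11] := c101.
have c20 : 0 < c2.
  by have /andP[A0 _] := ls_capA_range P; rewrite mulr_gt0// exprn_gt0.
pose c4 := b * c * kappa `^ (1 + b).
have c40 : 0 < c4 := mulr_gt0 (mulr_gt0 b0 c0) (powR_gt0 _ kappa0).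
pose W k := c2^-1 / c4 * e k `^ b + tail k.
suff : \forall k \near \oo, k.+1%:R^-1 <= W k - W k.+1.
  move=> [K' _ hK']; apply: (@harmonic_unbounded _ W K') => // k.
  have c24 : 0 <= c2^-1 / c4 by rewrite ltW// divr_gt0// invr_gt0.
  by rewrite addr_ge0 ?tail0// mulr_ge0 ?powR_ge0.
near=> k.
have Kk : (K <= k)%N by near: k; exact: nbhs_infty_ge.
have k1 : (0 < k)%N by near: k; exact: nbhs_infty_gt.
have kR : 1 <= k%:R :> R by rewrite ler1n.
have [_ decD] : (fl k = NPC -> c * ls_zeta P k ^+ 3 <= e k - e k.+1) /\
  (fl k <> NPC -> c * w k ^+ 4 * norm2 (g k) ^+ 2 <= e k - e k.+1) by near: k.
have flN : fl k <> NPC by near: k; exact: eventually_not_NPC.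
have kr : norm2 (x k - xs) < r by near: k; exact: iterate_near.
have ek : e k < eta by near: k; exact: gap_lt.
have gk0 : 0 < norm2 (g k) by rewrite norm2_gt0.
have wk0 : 0 < w k.
  have /andP[A0 _] := ls_capA_range P.
  by rewrite lt_min A0 mulr_gt0 ?ls_a_gt0// powR_gt0.
have ek0 : 0 < e k.
  have : 0 < e k - e k.+1.
    by rewrite (lt_le_trans _ (decD flN))// mulr_gt0 ?exprn_gt0// mulr_gt0// exprn_gt0.
  by have := gap_ge0 k.+1; lra.
have low : c1 * k%:R `^ (- (1 + b / 5)) <= norm2 (g k).
  apply: (glow k%:R _ (z k)) => //; first exact: norm2_ge0.
    by near: k.
  have [/(_ Kk)//|/negP] := big k; rewrite -leNgt => tz; apply: (le_trans tz).
  by rewrite zeta_def ge_min lexx orbT.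
have b01 : 0 < b < 1 by rewrite b0 b1.
have := harmonic_le (ls_capA_range P) (ls_alpha_range P) b01 c101 (ls_a_gt0 P k) kR low.
have W4 : 0 <= w k ^+ 4 by rewrite exprn_ge0// ltW.
have ee : 0 <= e k.+1 <= e k by rewrite gap_ge0 gap_le.
have e01 : 0 < e k <= 1 by rewrite ek0 (le_trans (ltW ek)).
have lojk : kappa * e k `^ theta <= norm2 (g k) by apply: loj; rewrite ?ek0.
have := lojasiewicz_rate theta_range kappa0 c0 gk0 W4 ee e01 lojk (decD flN).
rewrite -/b -/c4 -/c2 -/(w k) => rate harm.
apply: (@le_trans _ _ k%:R^-1).
  by rewrite lef_pV2 ?posrE ?ltr0n// ler_nat.
apply: (le_trans harm); rewrite /W tailS//.
suff : c2^-1 * (w k ^+ 4 * norm2 (g k) `^ (1 - b)) <=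
   c2^-1 / c4 * (e k `^ b - e k.+1 `^ b) by lra.
rewrite -mulrA ler_pM2l ?invr_gt0// -(ler_pM2l c40) (le_trans rate)//.
by rewrite mulrA divff ?gt_eqF// mul1r.
Unshelve. all: by end_near. Qed.

Lemma limit_properties : [/\ x @ \oo --> xs, grad f xs = 0,
  \forall k \near \oo, fl k <> NPC &
  forall (t : R) (K : nat), 0 < t -> exists2 k, (K <= k)%N & ls_zeta P k < t].
Proof.
split; [exact: cvg_iterates|exact: grad_limit|exact: eventually_not_NPC|].
exact: zeta_often_small.
Qed.

End Near.
End Run.

(** * Curvature at the limit *)

Lemma finite_nat_bounded (N : set nat) : finite_set N ->
  exists K : nat, forall k, (K <= k)%N -> ~ N k.
Proof.
move=> /finite_seqP[s ->]; exists (\max_(i <- s) i).+1 => k /= + ks.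
by rewrite ltnNge; move/negP; apply; exact: leq_bigmax_seq.
Qed.

(** Positive eigenvalues of H_k + ze_k I bound the form of H_k at unit vectors
    below by -ze_k, which is arbitrarily small along a subsequence. *)
Lemma psd_limit (R : realType) (n : nat) (H : nat -> 'M[R]_n) (H' : 'M[R]_n) (ze : nat -> R) :
  H @ \oo --> H' -> (forall k, H k \is symmetricmx) ->
  (forall e K, 0 < e -> exists2 k, (K <= k)%N & ze k < e) ->
  (\forall k \near \oo, 0 < lambda_min (H k + (ze k)%:M)) -> psd H'.
Proof.
move=> Hlim Hsym ze_small [K1 _ pos].
have entry i j : (fun k => H k i j) @ \oo --> H' i j.
  exact: (cvg_comp _ _ Hlim (@coord_continuous _ _ _ i j H')).
split.
  apply/is_hermitianmxP; rewrite expr0 scale1r map_mx_id//; apply/matrixP => i j.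
  rewrite mxE; apply: (cvg_unique _ (entry i j)) => //.
  have -> : (fun k => H k i j) = (fun k => H k j i).
    by apply/funext => k; rewrite -{1}(symmetricmx_tr (Hsym k)) mxE.
  exact: entry.
move=> v; rewrite leNgt; apply/negP => neg.
pose q := - dot v (H' *m v) / 3; have q0 : 0 < q by rewrite divr_gt0// oppr_gt0.
have S0 : 0 < n%:R * n%:R * dot v v + 1 :> R by rewrite ltr_wpDl// !mulr_ge0// dot_ge0.
have /cvgrPdist_lt/(_ _ (divr_gt0 q0 S0))[K2 _ near_H] := Hlim.
have N0 : 0 < dot v v + 1 by rewrite ltr_wpDl// dot_ge0.
have [k kK zek] := ze_small (q / (dot v v + 1)) (maxn K1 K2) (divr_gt0 q0 N0).
have [k1 k2] : (K1 <= k)%N /\ (K2 <= k)%N by move: kK; rewrite geq_max => /andP.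
have sym_k : H k + (ze k)%:M \is symmetricmx.
  apply/is_hermitianmxP; rewrite expr0 scale1r map_mx_id//.
  by rewrite linearD/= tr_scalar_mx (symmetricmx_tr (Hsym k)).
have := lambda_min_gt0_psd sym_k (pos k k1) v.
rewrite mulmxDl mul_scalar_mx dotDr dotZr.
have : dot v (H k *m v) - dot v (H' *m v) <= q.
  rewrite -dotNr -dotDr -mulmxBl (le_trans (CauchySchwarz_dot _ _))//.
  have := near_H k k2; rewrite /= distrC ltr_pdivlMr// mulrDr mulr1 => Hk.
  apply: (@le_trans _ _ (norm2 v * (n%:R * n%:R * `|H k - H'| * norm2 v))).
    by rewrite ler_wpM2l ?norm2_ge0// norm2_mulmx.
  have -> : norm2 v * (n%:R * n%:R * `|H k - H'| * norm2 v) =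
    n%:R * n%:R * `|H k - H'| * norm2 v ^+ 2 by ring.
  rewrite norm2_sqr; have := normr_ge0 (H k - H'); lra.
have : ze k * dot v v <= q.
  have [z0|z0] := leP (ze k) 0; first by rewrite (le_trans _ (ltW q0))// mulr_le0_ge0 ?dot_ge0.
  rewrite ltr_pdivlMr// in zek; rewrite (le_trans _ (ltW zek))// ler_pM2l//.
  by rewrite lerDl.
by rewrite /q; lra.
Qed.

Theorem theorem3p12 (R : realType) (n : nat) (f : 'cV[R]_n -> R)
    (P : minres_params R) (x : nat -> 'cV[R]_n) (B : nat -> 'M[R]_n)
    (d : nat -> 'cV[R]_n) (fl : nat -> flag) (lam : nat -> R)
    (f_C2 : twice_continuously_differentiable f)
    (x_run : minres_linesearch P f x B d fl lam)
    (VH : set 'cV[R]_n)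
    (VH_nbhs : set_nbhs (accumulation_points x) VH)
    (hess_lip : locally_lipschitz_on VH (hess f))
    (B_hess : forall k, B k = hess f (x k))
    (N_npc :
      let N := [set k | lambda_min (Bbar P B k) <= 0] in
      let Nnpc := [set k | N k /\ fl k = NPC] in
      infinite_set N -> infinite_set Nnpc)
    (capZ zexp zbar : R) (z : nat -> R)
    (capZ_gt0 : 0 < capZ)
    (zexp_range : 0 < zexp <= 3^-1)
    (zbar_gt0 : 0 < zbar)
    (z_lower : forall k, zbar <= z k)
    (zeta_def : forall k,
      ls_zeta P k = Num.min capZ (z k * norm2 (grad f (x k)) `^ zexp))
    (z_bigO : z =O_\oo (fun k => (k%:R * ln k%:R ^+ 2) `^ zexp))
    (a_summable : (\sum_(1 <= k <oo) (ls_a P k `^ (- (ls_alpha P)^-1))%:E < +oo)%E)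
    (z_summable : (\sum_(1 <= k <oo) (z k `^ (- zexp^-1))%:E < +oo)%E)
    (no_stop : forall k, grad f (x k) != 0)
    (xstar : 'cV[R]_n) (theta : R)
    (xstar_acc : accumulation_points x xstar)
    (theta_range : 0 <= theta < 1)
    (f_loj : lojasiewicz f xstar theta) :
  [/\ x @ \oo --> xstar, grad f xstar = 0 & psd (hess f xstar)].
Proof.
have [r1 [M [L [G [[r10 M1 L0 G1] grad_bd hess_bd hess_lp]]]]] :=
  local_bounds f_C2 (VH_nbhs _ xstar_acc) hess_lip.
have [r2 [kappa [eta [[r20 kappa0 eta0 eta1] loj]]]] :=
  lojasiewicz_bound theta_range f_loj.
pose r := Num.min r1 r2.
have r0 : 0 < r by rewrite lt_min r10.
have [rr1 rr2] : r <= r1 /\ r <= r2 by rewrite !ge_min !lexx orbT.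
have grad_bd' y : norm2 (y - xstar) < r -> norm2 (grad f y) <= G.
  by move=> yr; apply: grad_bd; exact: lt_le_trans rr1.
have rrr : r + r <= r1 + r1 by rewrite lerD.
have hess_bd' y v : norm2 (y - xstar) < r + r -> norm2 (hess f y *m v) <= M * norm2 v.
  by move=> yr; apply: hess_bd; exact: lt_le_trans rrr.
have hess_lp' y y' v : norm2 (y - xstar) < r + r -> norm2 (y' - xstar) < r + r ->
    norm2 ((hess f y - hess f y') *m v) <= L * norm2 (y - y') * norm2 v.
  by move=> yr y'r; apply: hess_lp; [exact: lt_le_trans yr rrr|exact: lt_le_trans y'r rrr].
have loj' y : norm2 (y - xstar) < r -> 0 < f y - f xstar < eta ->
    kappa * (f y - f xstar) `^ theta <= norm2 (grad f y).
  by move=> yr; apply: loj; exact: lt_le_trans rr2.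
have [x_lim g_lim [K _ no_NPC] zeta_small] := limit_properties f_C2 x_run B_hess no_stop r0
  M1 L0 G1 grad_bd' hess_bd' hess_lp' capZ_gt0 zexp_range zbar_gt0 z_lower zeta_def
  xstar_acc kappa0 eta0 eta1 theta_range loj' a_summable z_bigO.
split => //.
apply: (@psd_limit _ _ (fun k => hess f (x k)) _ (ls_zeta P)).
- by have [_ _ ch] := f_C2; exact: (cvg_comp _ _ x_lim (ch xstar)).
- by move=> k; apply: hess_sym x_run B_hess no_stop k.
- exact: zeta_small.
have : finite_set [set k | lambda_min (Bbar P B k) <= 0].
  apply: contrapT => /N_npc; apply; apply: (@sub_finite_set _ _ `I_K) (finite_II K).
  move=> k [_ flk] /=; rewrite ltnNge; apply/negP => Kk; exact: no_NPC k Kk flk.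
move=> /finite_nat_bounded[K' posK']; exists K' => // k /= Kk.
have /negP := posK' k Kk; rewrite -ltNge /= /Bbar B_hess; exact.
Qed.
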